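(* Let $\rho_3(z),\tau_3(z)$ be the bosonic screening currents, $\pi_1$ the action of the quantum toroidal algebra $\mathcal E_{2,1}=\mathcal E_2(q^{-k_1-2},q^2,q^{k_1})$, $p_3=q^{2(k_3+2)}$, and let $F_i^{dress}(z,p)$ be the dressed currents, all as in the context. Then $$z\rho_3(z)=e^{s\bar Q_{u_1}}\,\pi_1\bigl(F_1^{dress}(z,p_3)\bigr)\,z^{-\lambda h_{1,0}},\qquad z\tau_3(z)=e^{-s\bar Q_{u_1}}\,\pi_1\bigl(F_0^{dress}(z,p_3)\bigr)\,z^{\lambda h_{1,0}},$$ where $\bar Q_{u_1}=\frac{1}{k_3+2}\bigl(k_1Q_{a_1}-(k_2+2)Q_{a_2}-(k_3+2)Q_{a_3}\bigr)$ and $$\lambda=\frac{1-(k_2+2)s}{k_3+2}.$$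
   Context: Fix $q\in\mathbb C^\times$ with $|q|<1$ (and a choice of $\log q$, $q^x=e^{x\log q}$), and put $[x]=(q^x-q^{-x})/(q-q^{-1})$. Fix generic $k_1,k_2,k_3\in\mathbb C$ with $k_1+k_2+k_3=-4$, and assume $|p_i|<1$ for $p_i=q^{2(k_i+2)}$, $i=1,2,3$. **Free fields.** Operators $a_{i,n}$ ($n\in\mathbb Z$), $Q_{a_i}$, $i=0,1,2,3$. The oscillators $a_{i,n}$ ($n\ne0$) are independent; the zero modes satisfy $\sum_{i=0}^3a_{i,0}=0$, $\sum_{i=0}^3Q_{a_i}=0$. For $n\neq0$: $[a_{i,n},a_{i,-n}]=n$, $[a_{i,0},Q_{a_i}]=1$ ($0\le i\le3$); $[a_{0,n},a_{i,-n}]=n\frac{[(k_i+1)n]}{[n]}$, $[a_{0,0},Q_{a_i}]=[a_{i,0},Q_{a_0}]=k_i+1$ ($i=1,2,3$); $[a_{i,n},a_{j,-n}]=n\frac{[(k_l+1)n]}{[n]}$, $[a_{i,0},Q_{a_j}]=k_l+1$ for $\{i,j,l\}=\{1,2,3\}$; all other commutators vanish. They act on the Fock space $\mathcal H=\bigoplus_\beta\mathbb C[a_{i,-n}\mid n>0,\,0\le i\le3]\otimes\mathbb Ce^\beta$, $\beta\in\bigoplus_{i=1}^3\mathbb CQ_{a_i}$, where $a_{i,n}$ ($n>0$) kills $e^\beta$, $a_{i,0}e^\beta=[a_{i,0},\beta]e^\beta$, $e^Qe^\beta=e^{\beta+Q}$. Normal ordering $:\ :$ puts $Q_{a_i},a_{i,n}$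 ($n<0$) to the left of $a_{i,n}$ ($n\ge0$). **Screening currents.** $a_i(N;z)=\frac1N(Q_{a_i}+a_{i,0}\log z)-\sum_{n\ne0}\frac{[n]}{[Nn]}\frac{a_{i,n}}nz^{-n}$, $r_3^\pm(z)=-a_1(k_3+2;z)-a_2(k_3+2;q^{\mp(k_3+2)}z)$, $\ t_3^\pm(z)=-a_0(k_3+2;z)-a_3(k_3+2;q^{\mp(k_3+2)}z)$, $\rho_3(z)=\frac{1}{(q-q^{-1})z}(:e^{r_3^+(z)}:-:e^{r_3^-(z)}:)$, $\ \tau_3(z)=\frac{1}{(q-q^{-1})z}(:e^{t_3^+(z)}:-:e^{t_3^-(z)}:)$. **Action $\pi_1$ of $\mathcal E_{2,1}$.** Of the generating currents of the quantum toroidal $\mathfrak{gl}_2$ algebra only $F_i(z)$ and $H_{i,n}$ ($i=0,1$, $n>0$) are needed; their images are $\pi_1(F_1(z))=\frac1{q-q^{-1}}(:e^{v_1^+(z)}:-:e^{v_1^-(z)}:)$, $\ \pi_1(F_0(z))=\frac1{q-q^{-1}}(:e^{\hat v_1^+(z)}:-:e^{\hat v_1^-(z)}:)$, $\ \pi_1(H_{1,n})=h_{1,n}$, $\ \pi_1(H_{0,n})=\hat h_{1,n}$, where, for an arbitrary complex parameter $s$ with $1+k_1s\ne0$: $Q_{u_1}=\frac{1}{k_3+2}(Q_{a_1}+Q_{a_2})+s\bar Q_{u_1}$, $u_{1,0}=-\frac1{k_2+2}(a_{1,0}+a_{3,0})+\frac{s}{1+k_1s}\bar u_{1,0}$, $\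 \bar u_{1,0}=\frac1{k_2+2}\bigl(k_1a_{1,0}-(k_2+2)a_{2,0}-(k_3+2)a_{3,0}\bigr)$, $\ h_{1,0}=-\frac1{1+k_1s}\bar u_{1,0}$, $v_1^\pm(z)=-(Q_{u_1}+u_{1,0}\log z)\pm a_{2,0}\log q-\sum_{n\ne0}\frac{v_{1,n}^\pm}{n}z^{-n}$, $\hat v_1^\pm(z)=Q_{u_1}+u_{1,0}\log z\pm a_{3,0}\log q-\sum_{n\ne0}\frac{\hat v_{1,n}^\pm}{n}z^{-n}$, $v_{1,n}^-=-\frac{[n]}{[(k_3+2)n]}(a_{1,n}+q^{-(k_3+2)n}a_{2,n})$ for $n<0$, $\ v_{1,n}^-=\frac{[n]}{[(k_2+2)n]}(q^{k_1n}a_{1,n}+q^{-(k_3+2)n}a_{3,n})$ for $n>0$, $\ v_{1,n}^+=v_{1,n}^--(q^n-q^{-n})a_{2,n}$; $\hat v_{1,n}^-=-\frac{[n]}{[(k_3+2)n]}(a_{0,n}+q^{-(k_3+2)n}a_{3,n})$ for $n<0$, $\ \hat v_{1,n}^-=\frac{[n]}{[(k_2+2)n]}(q^{k_1n}a_{0,n}+q^{-(k_3+2)n}a_{2,n})$ for $n>0$, $\ \hat v_{1,n}^+=\hat v_{1,n}^--(q^n-q^{-n})a_{3,n}$; for $n>0$: $h_{1,n}=-\frac{[n]}{n[(k_2+2)n]}\bigl([k_1n]a_{1,n}-[(k_2+2)n]a_{2,n}-[(k_3+2)n]a_{3,n}\bigr)$, $\ \hat h_{1,n}=-\frac{[n]}{n[(k_2+2)n]}\bigl([k_1n]a_{0,n}-[(k_3+2)n]a_{2,n}-[(k_2+2)n]a_{3,n}\bigr)$.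 **Dressed currents.** $F_i^{dress}(z,p)=F_i(z)\exp\Bigl(-(q-q^{-1})\sum_{n>0}\frac{1}{1-p^n}H_{i,n}z^{-n}\Bigr)$, $i=0,1$. The identities are identities of formal series in (complex) powers of $z$ with operator coefficients on $\mathcal H$. *)

(* Defs.v *)
From HB Require Import structures.
From mathcomp Require Import all_boot all_order all_algebra finmap.
From mathcomp Require Import all_classical reals.
From mathcomp Require Import sequences exp trigo.
From mathcomp Require Import complex.
From mathcomp Require Import monalg.
From mathcomp Require Import ring.

Set Implicit Arguments.
Unset Strict Implicit.
Unset Printing Implicit Defensive.

Import Order.TTheory GRing.Theory Num.Theory.

Local Open Scope classical_set_scope.
Local Open Scope ring_scope.

Section LinearExtension.
Variables (K : choiceType) (A : nzRingType) (V : lmodType A).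
Implicit Types (f : K -> V) (u v : {malg A[K]}).

Definition lext f v : V := \sum_(b <- msupp v) v@_b *: f b.

Lemma lext_sub f v (d : {fset K}) : (msupp v `<=` d)%fset ->
  lext f v = \sum_(b <- d) v@_b *: f b.
Proof.
move=> le; rewrite /lext (big_fset_incl _ le) // => b _ /mcoeff_outdom ->.
by rewrite scale0r.
Qed.

Lemma lext_is_linear f : linear (lext f).
Proof.
move=> c u v; pose d := (msupp u `|` msupp v `|` msupp (c *: u + v))%fset.
have le_uv : (msupp u `|` msupp v `<=` d)%fset by apply: fsubsetUl.
rewrite (@lext_sub f u d) ?(fsubset_trans (fsubsetUl _ _) le_uv) //.
rewrite (@lext_sub f v d) ?(fsubset_trans (fsubsetUr _ _) le_uv) //.
rewrite (@lext_sub f _ d) ?fsubsetUr //.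
rewrite scaler_sumr -big_split; apply: eq_bigr => b _ /=.
by rewrite mcoeffD mcoeffZ scalerDl scalerA.
Qed.

HB.instance Definition _ f :=
  GRing.isLinear.Build A {malg A[K]} V *:%R (lext f) (lext_is_linear f).

Lemma lextU f (b : K) : lext f << b >> = f b.
Proof.
rewrite (@lext_sub f _ [fset b]%fset) ?msuppU_le //.
by rewrite big_seq_fset1 mcoeffUU scale1r.
Qed.

Lemma malgUZ (c : A) (k : K) : << c *g k >> = c *: << k >>.
Proof. by apply/malgP => x; rewrite mcoeffZ !mcoeffU mulr_natr. Qed.

Lemma malg_ext (f g : {linear {malg A[K]} -> V}) :
  (forall b : K, f << b >> = g << b >>) -> f =1 g.
Proof.
move=> fg v; rewrite [v]monalgE !linear_sum; apply: eq_bigr => b _.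
by rewrite malgUZ !linearZ /= fg.
Qed.

End LinearExtension.

Section FockSpace.
Variable A : fieldType.

(* The pair (i, n) : 'I_4 * nat stands for the creation mode a_{i,-(n+1)}. *)
Definition creation := ('I_4 * nat)%type.

(* The row vector (b_1, b_2, b_3) stands for
   beta = b_1 Q_{a_1} + b_2 Q_{a_2} + b_3 Q_{a_3}. *)
Definition charge := 'rV[A]_3.

(* Basis: products of creation modes times e^beta. *)
Definition fbasis : choiceType := ({cmonom creation} * charge)%type.

Definition fock : lmodType A := {malg A[fbasis]}.

End FockSpace.

(* m e^beta *)
HB.lock Definition fvec (A : fieldType) (m : {cmonom creation})
  (beta : charge A) : fock A := << ((m, beta) : fbasis A) >>.

(* The linear operator on the Fock space with given values on the basis. *)
HB.lock Definition flin (A : fieldType)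
  (f : {cmonom creation} -> charge A -> fock A) : fock A -> fock A :=
  lext (fun b : fbasis A => f b.1 b.2).

Section FockSpaceTheory.
Variable A : fieldType.
Local Notation charge := (charge A).
Local Notation fock := (fock A).
Implicit Types (f : {cmonom creation} -> charge -> fock).

Lemma flin_is_linear f : linear (flin f).
Proof. by rewrite unlock; apply: lext_is_linear. Qed.

HB.instance Definition _ f :=
  GRing.isLinear.Build A fock fock *:%R (flin f) (flin_is_linear f).

Lemma flinE f m beta : flin f (fvec m beta) = f m beta.
Proof. by rewrite !unlock lextU. Qed.

Lemma fock_ext (f g : {linear fock -> fock}) :
  (forall m beta, f (fvec m beta) = g (fvec m beta)) -> f =1 g.
Proof.
move=> fg; apply: malg_ext => -[m beta].
by have := fg m beta; rewrite unlock.
Qed.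

End FockSpaceTheory.

Section OperatorSeries.
Variable A : fieldType.
Local Notation H := (fock A).

(* X : opser is the series \sum_g X g z^g.  All sums over exponents below are
   finite-support sums on each vector of H. *)
Definition opser := A -> H -> H.

Definition sconst (T : H -> H) : opser :=
  fun g v => if g == 0 then T v else 0.

(* multiplication by the scalar z^c *)
Definition smonom (c : A) (X : opser) : opser := fun g => X (g - c).

Definition sadd (X Y : opser) : opser := fun g v => X g v + Y g v.
Definition sscale (c : A) (X : opser) : opser := fun g v => c *: X g v.
Definition ssub (X Y : opser) : opser := sadd X (sscale (-1) Y).

Definition smul (X Y : opser) : opser :=
  fun g v => \sum_(h \in [set: A]) X (g - h) (Y h v).

Definition spow (X : opser) (m : nat) : opser := iter m (smul X) (sconst id).

Definition sexp (X : opser) : opser :=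
  fun g v => \sum_(m \in [set: nat]) (m`!%:R : A)^-1 *: spow X m g v.

(* \sum_{n | P n} T_n z^{-n} *)
Definition modeser (P : pred int) (T : int -> H -> H) : opser :=
  fun g v => \sum_(n \in [set n : int | P n /\ (- n)%:~R = g]) T n v.

End OperatorSeries.

Notation "X ** Y" := (smul X Y) (at level 40, left associativity).

Section Modes.
Variable A : fieldType.
Local Notation H := (fock A).

(* [a_{i,n}, a_{j,-n}] = n * gram n i j for n != 0;
   [a_{i,0}, Q_{a_j}] = gram 0 i j. *)
Variable gram : int -> 'I_4 -> 'I_4 -> A.

(* The exponential function on scalars, applied to the eigenvalues of the
   zero modes. *)
Variable ex : A -> A.

(* A row vector c : 'rV_4 stands for the linear combination \sum_i c_i x_i of
   x_i = a_{i,n} (fixed n) or of x_i = Q_{a_i}. *)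

(* Class in the charge space of \sum_i c_i Q_{a_i}, using
   Q_{a_0} = - Q_{a_1} - Q_{a_2} - Q_{a_3}. *)
Definition chargeQ (c : 'rV[A]_4) : charge A :=
  \row_(j < 3) (c 0 (lift ord0 j) - c 0 ord0).

(* [\sum_i c_i a_{i,0}, beta] *)
Definition zpair (c : 'rV[A]_4) (beta : charge A) : A :=
  \sum_(i < 4) \sum_(j < 3) c 0 i * beta 0 j * gram 0 i (lift ord0 j).

Definition av (i : nat) : 'rV[A]_4 := \row_(j < 4) (nat_of_ord j == i)%:R.

Definition osc (i : 'I_4) (n : int) : H -> H := flin (fun m beta =>
  match n with
  | Posz 0 => zpair (av i) beta *: fvec m beta
  | Posz p.+1 =>
      \sum_(j < 4) (n%:~R * gram n i j * (m (j, p))%:R)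
         *: fvec (divcm m (ucm (j, p))) beta
  | Negz p => fvec (mulcm (ucm (i, p)) m) beta
  end).

(* \sum_i c_i a_{i,n} *)
Definition oscl (c : 'rV[A]_4) (n : int) : H -> H :=
  fun v => \sum_(i < 4) c 0 i *: osc i n v.

(* e^{\sum_i c_i Q_{a_i}} *)
Definition expQ (c : 'rV[A]_4) : H -> H :=
  flin (fun m beta => fvec m (beta + chargeQ c)).

(* e^{\sum_i c_i a_{i,0}} *)
Definition expA (c : 'rV[A]_4) : H -> H :=
  flin (fun m beta => ex (zpair c beta) *: fvec m beta).

(* z^{\sum_i c_i a_{i,0}} *)
Definition zpowA (c : 'rV[A]_4) : opser A :=
  fun g => flin (fun m beta => if zpair c beta == g then fvec m beta else 0).

HB.instance Definition _ i n := GRing.Linear.on (osc i n).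
HB.instance Definition _ c := GRing.Linear.on (expQ c).

(* The field with components (Q, L, B, o) is
   Q + L_0 log z + B_0 + \sum_{n != 0} (o n)_n z^{-n},
   where Q is a combination of the Q_{a_i}, L_0 and B_0 of the a_{i,0}, and
   (o n)_n of the a_{i,n}; the value of o at 0 is irrelevant. *)
Record ffield := FField {
  fQ : 'rV[A]_4;
  fL : 'rV[A]_4;
  fB : 'rV[A]_4;
  fo : int -> 'rV[A]_4 }.

Definition fadd (f g : ffield) : ffield :=
  FField (fQ f + fQ g) (fL f + fL g) (fB f + fB g) (fun n => fo f n + fo g n).

Definition fopp (f : ffield) : ffield :=
  FField (- fQ f) (- fL f) (- fB f) (fun n => - fo f n).

(* :e^{f(z)}: *)
Definition vertex (f : ffield) : opser A :=
  sconst (expQ (fQ f))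
  ** sexp (modeser (fun n => n < 0) (fun n => oscl (fo f n) n))
  ** zpowA (fL f)
  ** sconst (expA (fB f))
  ** sexp (modeser (fun n => 0 < n) (fun n => oscl (fo f n) n)).

(* Checks that the operators above satisfy the commutation relations encoded by
   gram; agramC, agramN and sum_agram0 below discharge the hypotheses. *)

Hypothesis gramC : forall n i j, gram n i j = gram n j i.
Hypothesis gramN : forall (n : int) i j, gram (- n) i j = gram n i j.

Lemma oscl_av (i : 'I_4) n v : oscl (av i) n v = osc i n v.
Proof.
rewrite /oscl (bigD1 i) //= big1 => [|j /negPf ji]; last first.
  by rewrite mxE -val_eqE in ji *; rewrite ji scale0r.
by rewrite addr0 mxE eqxx scale1r.
Qed.

Lemma oscZ i n (c : A) v : osc i n (c *: v) = c *: osc i n v.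
Proof. exact: linearZ_LR. Qed.

Lemma osc0E i m beta :
  osc i 0 (fvec m beta) = zpair (av i) beta *: fvec m beta.
Proof. exact: flinE. Qed.

Lemma oscSE i (p : nat) m beta :
  osc i p.+1 (fvec m beta) =
  \sum_(j < 4) (p.+1%:R * gram p.+1 i j * (m (j, p))%:R)
     *: fvec (divcm m (ucm (j, p))) beta.
Proof. exact: flinE. Qed.

Lemma oscNE i p m beta :
  osc i (Negz p) (fvec m beta) = fvec (mulcm (ucm (i, p)) m) beta.
Proof. exact: flinE. Qed.

Lemma expQE c m beta : expQ c (fvec m beta) = fvec m (beta + chargeQ c).
Proof. exact: flinE. Qed.

Lemma osc0_comm i j n v : osc i 0 (osc j n v) = osc j n (osc i 0 v).
Proof.
apply: (@fock_ext _ (osc i 0 \o osc j n) (osc j n \o osc i 0)) => m beta /=.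
rewrite osc0E linearZ /=; case: n => [[|n]|n].
- by rewrite !osc0E linearZ /= osc0E !scalerA mulrC.
- rewrite oscSE linear_sum scaler_sumr; apply: eq_bigr => a _.
  by rewrite linearZ /= osc0E !scalerA mulrC.
- by rewrite oscNE osc0E.
Qed.

Lemma oscSSE i j (m n : nat) x beta :
  osc i m.+1 (osc j n.+1 (fvec x beta)) =
  \sum_(a < 4) \sum_(c < 4)
    ((n.+1%:R * gram n.+1 j a * (x (a, n))%:R)
     * (m.+1%:R * gram m.+1 i c * (divcm x (ucm (a, n)) (c, m))%:R))
    *: fvec (divcm (divcm x (ucm (a, n))) (ucm (c, m))) beta.
Proof.
rewrite oscSE linear_sum; apply: eq_bigr => a _; rewrite /= oscZ oscSE scaler_sumr.
by apply: eq_bigr => c _; rewrite scalerA.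
Qed.

Lemma osc_ann_comm i j (m n : nat) v :
  osc i m.+1 (osc j n.+1 v) = osc j n.+1 (osc i m.+1 v).
Proof.
apply: (@fock_ext _ (osc i m.+1 \o osc j n.+1) (osc j n.+1 \o osc i m.+1)).
move=> x beta /=; rewrite !oscSSE [LHS]exchange_big.
apply: eq_bigr => a _; apply: eq_bigr => c _ /=.
have -> : divcm (divcm x (ucm (c, n))) (ucm (a, m))
    = divcm (divcm x (ucm (a, m))) (ucm (c, n)).
  by apply/eqP/cmP => y; rewrite !divcmE -!subnDA addnC.
apply: (congr1 (fun t => t *: fvec _ beta)); rewrite !divcmE !cmU.
move: (gram n.+1 j c) (gram m.+1 i a) (n.+1%:R : A) (m.+1%:R : A).
move=> g h p r; rewrite mulrACA [RHS]mulrACA [r * h * _]mulrC -!natrM.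
apply: (congr1 (fun t : nat => p * g * (r * h) * t%:R)).
by case: (eqVneq (c, n) (a, m)) => [->|_] //; rewrite !subn0 mulnC.
Qed.

Lemma osc_cre_comm i j (m n : nat) v :
  osc i (Negz m) (osc j (Negz n) v) = osc j (Negz n) (osc i (Negz m) v).
Proof.
apply: (@fock_ext _ (osc i (Negz m) \o osc j (Negz n))
                    (osc j (Negz n) \o osc i (Negz m))).
move=> x beta /=; rewrite !oscNE; congr fvec.
by apply/eqP/cmP => y; rewrite !mulcmE addnCA.
Qed.

Lemma osc_ann_cre i j (m n : nat) v :
  osc i m.+1 (osc j (Negz n) v) - osc j (Negz n) (osc i m.+1 v)
  = (if m == n then m.+1%:R * gram m.+1 i j else 0) *: v.
Proof.
pose f := osc i m.+1 \o osc j (Negz n); pose g := osc j (Negz n) \o osc i m.+1.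
pose c : A := if m == n then m.+1%:R * gram m.+1 i j else 0.
suff: f v - g v = c *: v by [].
apply/eqP; rewrite subr_eq; apply/eqP.
apply: (@fock_ext _ f ((c \*: idfun) \+ g)) => x beta; rewrite /f /g /=.
rewrite oscNE !oscSE linear_sum.
have key (a : 'I_4) :
    (m.+1%:R * gram m.+1 i a * (mulcm (ucm (j, n)) x (a, m))%:R)
      *: fvec (divcm (mulcm (ucm (j, n)) x) (ucm (a, m))) beta
    = ((if (a == j) && (m == n) then m.+1%:R * gram m.+1 i a else 0)
         *: fvec x beta)
      + (m.+1%:R * gram m.+1 i a * (x (a, m))%:R)
        *: fvec (mulcm (ucm (j, n)) (divcm x (ucm (a, m)))) beta.
  rewrite mulcmE cmU xpair_eqE [j == a]eq_sym [n == m]eq_sym.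
  have [/andP[/eqP -> /eqP ->]|ne] := boolP ((a == j) && (m == n)).
    have -> : divcm (mulcm (ucm (j, n)) x) (ucm (j, n)) = x.
      by apply/eqP/cmP => y; rewrite divcmE mulcmE addnC addnK.
    have [x0|x0] := posnP (x (j, n)).
      by rewrite x0 mulr0 scale0r !addr0 mulr1.
    have -> : mulcm (ucm (j, n)) (divcm x (ucm (j, n))) = x.
      apply/eqP/cmP => y; rewrite mulcmE divcmE cmU subnKC //.
      by case: eqVneq => [<-|].
    by rewrite -scalerDl natrD mulrDr mulr1.
  rewrite add0n scale0r add0r; have [->|x0] := posnP (x (a, m)).
    by rewrite mulr0 !scale0r.
  congr (_ *: fvec _ _); apply/eqP/cmP => y.
  rewrite !(mulcmE, divcmE) !cmU addnBA //.
  by case: eqVneq => [<-|].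
rewrite (eq_bigr _ (fun a _ => key a)) big_split; congr (_ + _); last first.
  by apply: eq_bigr => a _; rewrite /= oscZ oscNE.
rewrite (bigD1 j) //= big1 ?addr0 => [|a /negPf ->]; last exact: scale0r.
by rewrite eqxx.
Qed.

Lemma osc_comm i j (m n : int) v :
  osc i m (osc j n v) - osc j n (osc i m v)
  = (if (m != 0) && (m + n == 0) then m%:~R * gram m i j else 0) *: v.
Proof.
case: m => [[|m]|m]; first by rewrite osc0_comm subrr eqxx scale0r.
  case: n => [[|n]|n]; first by rewrite -osc0_comm subrr addr0 andbN scale0r.
    by rewrite osc_ann_comm subrr scale0r.
  by rewrite osc_ann_cre NegzE subr_eq0.
case: n => [[|n]|n]; first by rewrite -osc0_comm subrr addr0 andbN scale0r.
  rewrite -opprB osc_ann_cre -scaleNr NegzE.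
  apply: (congr1 (fun t => t *: v)).
  rewrite oppr_eq0 addrC subr_eq0 /= eqz_nat eqSS.
  case: eqP => [->|_]; last by rewrite oppr0.
  by rewrite gramN gramC rmorphN /= mulNr.
by rewrite osc_cre_comm subrr scale0r.
Qed.

Lemma osc0_expQ (c : 'rV[A]_4) i v :
  osc i 0 (expQ c v) - expQ c (osc i 0 v)
  = zpair (av i) (chargeQ c) *: expQ c v.
Proof.
pose f := expQ c \o osc i 0.
apply/eqP; rewrite subr_eq; apply/eqP.
apply: (@fock_ext _ (osc i 0 \o expQ c)
  ((zpair (av i) (chargeQ c) \*: expQ c) \+ f)) => m beta.
rewrite /f /= osc0E linearZ /= !expQE osc0E -scalerDl.
apply: (congr1 (fun t => t *: fvec m _)).
rewrite addrC /zpair -big_split; apply: eq_bigr => a _.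
rewrite -big_split; apply: eq_bigr => b _ /=.
by rewrite -mulrDl -mulrDr; congr (_ * _ * _); rewrite !mxE.
Qed.

Lemma av0E (i j : 'I_4) : av i 0 j = (j == i)%:R.
Proof. by rewrite mxE. Qed.

Lemma chargeQE c (b : 'I_3) :
  chargeQ c 0 b = c 0 (lift ord0 b) - c 0 ord0.
Proof. by rewrite mxE. Qed.

Lemma zpair_av (i : 'I_4) beta :
  zpair (av i) beta = \sum_(b < 3) beta 0 b * gram 0 i (lift ord0 b).
Proof.
rewrite /zpair (bigD1 i) //= [X in _ + X]big1 ?addr0 => [|a ai]; last first.
  by rewrite big1 // => b _; rewrite av0E (negPf ai) !mul0r.
by apply: eq_bigr => b _; rewrite av0E eqxx mul1r.
Qed.

Lemma zpair_chargeQ (i j : 'I_4) :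
  (forall l, \sum_(b < 4) gram 0 l b = 0) ->
  zpair (av i) (chargeQ (av j)) = gram 0 i j.
Proof.
move=> /(_ i); rewrite big_ord_recl => /eqP; rewrite addr_eq0 => /eqP G0.
rewrite zpair_av; have [j' ->|->] := unliftP ord0 j; last first.
  rewrite G0 -sumrN; apply: eq_bigr => b _.
  by rewrite chargeQE !av0E sub0r mulN1r.
rewrite (bigD1 j') // -[RHS]addr0; congr (_ + _).
  by rewrite chargeQE !av0E eqxx subr0 mul1r.
rewrite big1 // => b bj.
by rewrite chargeQE !av0E (inj_eq lift_inj) (negPf bj) subr0 mul0r.
Qed.

Lemma sum_osc0 v : (forall l, \sum_(b < 4) gram 0 l b = 0) ->
  \sum_(i < 4) osc i 0 v = 0.
Proof.
move=> sum0; pose f : H -> H := fun v => \sum_(i < 4) osc i 0 v.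
have f_lin : linear f.
  move=> c u w; rewrite /f scaler_sumr -big_split; apply: eq_bigr => i _.
  exact: linearP.
pose fL := GRing.isLinear.Build A H H *:%R f f_lin.
pose F : {linear H -> H} := HB.pack f fL.
apply: (@fock_ext _ F \0) => m beta; rewrite /= /f.
rewrite (eq_bigr _ (fun (i : 'I_4) _ => osc0E i m beta)) -scaler_suml.
rewrite (eq_bigr _ (fun (i : 'I_4) _ => zpair_av i beta)) exchange_big.
rewrite big1 ?scale0r //= => b _.
rewrite -mulr_sumr (eq_bigr _ (fun i _ => gramC 0 i _)).
by rewrite sum0 mulr0.
Qed.

Lemma expQ_sum v : expQ (\sum_(i < 4) av i) v = v.
Proof.
apply: (@fock_ext _ (expQ _) idfun) => m beta; rewrite /= expQE.
rewrite [chargeQ _](_ : _ = 0) ?addr0 //; apply/rowP => j.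
have av_sum i : (\sum_(a < 4) av a) 0 i = 1.
  rewrite summxE (bigD1 i) //= big1 => [|a ai]; first by rewrite av0E eqxx addr0.
  by rewrite av0E eq_sym (negPf ai).
by rewrite chargeQE !av_sum subrr mxE.
Qed.

End Modes.

Section QNumbers.
Variable R : realType.
Local Notation C := R[i].

Definition cexp (x : C) : C :=
  ((expR (complex.Re x) * cos (complex.Im x))
   +i* (expR (complex.Re x) * sin (complex.Im x)))%C.

(* q^x for the branch given by logq, a chosen logarithm of q *)
Definition qpow (logq x : C) : C := cexp (x * logq).

(* q - q^{-1} *)
Definition qdiff (logq : C) : C := cexp logq - (cexp logq)^-1.

Definition qnum (logq x : C) : C :=
  (qpow logq x - qpow logq (- x)) / qdiff logq.

Lemma qnumN (logq x : C) : qnum logq (- x) = - qnum logq x.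
Proof. by rewrite /qnum opprK -mulNr opprB. Qed.

End QNumbers.

Section Currents.
Variable R : realType.
Local Notation C := R[i].
Local Notation H := (fock C).
Local Notation av := (av C).
Local Notation ffield := (ffield C).
Variables (logq k1 k2 k3 : C).

Definition lev (i : nat) : C := match i with 1 => k1 | 2 => k2 | _ => k3 end%N.

(* For i != j: the k_l entering [a_i, a_j], where l is the nonzero one of i, j
   if 0 is among them, and {i, j, l} = {1, 2, 3} otherwise. *)
Definition klev (i j : nat) : C :=
  lev (if (i * j == 0)%N then i + j else 6 - (i + j))%N.

Definition agram (n : int) (i j : 'I_4) : C :=
  if i == j then 1
  else if n == 0 then klev i j + 1
  else qnum logq ((klev i j + 1) * n%:~R) / qnum logq n%:~R.

Lemma agramC n i j : agram n i j = agram n j i.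
Proof. by rewrite /agram eq_sym /klev mulnC addnC. Qed.

Lemma agramN n i j : agram (- n) i j = agram n i j.
Proof.
by rewrite /agram oppr_eq0 !rmorphN /= mulrN !qnumN invrN mulrNN.
Qed.

Lemma sum_agram0 i : k1 + k2 + k3 = - 4 -> \sum_(j < 4) agram 0 i j = 0.
Proof.
move=> sum_k; have k3E : k3 = - 4 - k1 - k2 by rewrite -sum_k; ring.
rewrite !big_ord_recl big_ord0 /agram /klev.
by case: i => [[|[|[|[|i]]]] hi] //=; rewrite k3E; ring.
Qed.

Local Notation vertex := (vertex agram (@cexp R)).
Local Notation oscl := (oscl agram).

(* f(q^c z), with log (q^c z) = log z + c log q *)
Definition fshift (c : C) (f : ffield) : ffield :=
  FField (fQ f) (fL f) (fB f + (c * logq) *: fL f)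
    (fun n => qpow logq (- c * n%:~R) *: fo f n).

Definition afield (i : nat) (N : C) : ffield :=
  FField (N^-1 *: av i) (N^-1 *: av i) 0
    (fun n => - (qnum logq n%:~R / qnum logq (N * n%:~R) / n%:~R) *: av i).

(* The superscripts + and - of the fields are encoded as true and false. *)
Definition sg (b : bool) : C := if b then 1 else -1.

Definition r3 (b : bool) : ffield :=
  fadd (fopp (afield 1 (k3 + 2)))
       (fopp (fshift (- sg b * (k3 + 2)) (afield 2 (k3 + 2)))).

Definition t3 (b : bool) : ffield :=
  fadd (fopp (afield 0 (k3 + 2)))
       (fopp (fshift (- sg b * (k3 + 2)) (afield 3 (k3 + 2)))).

Definition rho3 : opser C :=
  sscale (qdiff logq)^-1
    (smonom (- 1) (ssub (vertex (r3 true)) (vertex (r3 false)))).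

Definition tau3 : opser C :=
  sscale (qdiff logq)^-1
    (smonom (- 1) (ssub (vertex (t3 true)) (vertex (t3 false)))).

Variable s : C.

Definition barQu1 : 'rV[C]_4 :=
  (k3 + 2)^-1 *: (k1 *: av 1 - (k2 + 2) *: av 2 - (k3 + 2) *: av 3).

Definition Qu1 : 'rV[C]_4 := (k3 + 2)^-1 *: (av 1 + av 2) + s *: barQu1.

Definition baru10 : 'rV[C]_4 :=
  (k2 + 2)^-1 *: (k1 *: av 1 - (k2 + 2) *: av 2 - (k3 + 2) *: av 3).

Definition u10 : 'rV[C]_4 :=
  - (k2 + 2)^-1 *: (av 1 + av 3) + (s / (1 + k1 * s)) *: baru10.

Definition h10 : 'rV[C]_4 := - (1 + k1 * s)^-1 *: baru10.

Local Notation "q^ x" := (qpow logq x) (at level 2, x at level 1).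
Local Notation "[[ x ]]" := (qnum logq x).

(* Coefficient vectors of v_{1,n}^- and \hat v_{1,n}^-: the two are related by
   exchanging a_1 with a_0 and a_2 with a_3. *)
Definition vminus (x y z : 'rV[C]_4) (n : int) : 'rV[C]_4 :=
  if n < 0 then
    - ([[n%:~R]] / [[(k3 + 2) * n%:~R]])
      *: (x + q^(- (k3 + 2) * n%:~R) *: y)
  else
    ([[n%:~R]] / [[(k2 + 2) * n%:~R]])
      *: (q^(k1 * n%:~R) *: x + q^(- (k3 + 2) * n%:~R) *: z).

Definition v1n (b : bool) (n : int) : 'rV[C]_4 :=
  let vm := vminus (av 1) (av 2) (av 3) n in
  if b then vm - (q^(n%:~R) - q^(- n%:~R)) *: av 2 else vm.

Definition hatv1n (b : bool) (n : int) : 'rV[C]_4 :=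
  let vm := vminus (av 0) (av 3) (av 2) n in
  if b then vm - (q^(n%:~R) - q^(- n%:~R)) *: av 3 else vm.

Definition v1 (b : bool) : ffield :=
  FField (- Qu1) (- u10) ((sg b * logq) *: av 2)
    (fun n => - n%:~R^-1 *: v1n b n).

Definition hatv1 (b : bool) : ffield :=
  FField Qu1 u10 ((sg b * logq) *: av 3)
    (fun n => - n%:~R^-1 *: hatv1n b n).

Definition h1 (n : int) : 'rV[C]_4 :=
  - ([[n%:~R]] / (n%:~R * [[(k2 + 2) * n%:~R]]))
  *: ([[k1 * n%:~R]] *: av 1 - [[(k2 + 2) * n%:~R]] *: av 2
      - [[(k3 + 2) * n%:~R]] *: av 3).

Definition hath1 (n : int) : 'rV[C]_4 :=
  - ([[n%:~R]] / (n%:~R * [[(k2 + 2) * n%:~R]]))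
  *: ([[k1 * n%:~R]] *: av 0 - [[(k3 + 2) * n%:~R]] *: av 2
      - [[(k2 + 2) * n%:~R]] *: av 3).

(* Of the action pi_1 only the images of F_i(z) and of H_{i,n}, n > 0, enter;
   the image of a dressed current is the dressing of these images. *)
Definition pi1_F (i : 'I_2) : opser C :=
  let v := if i == 0 then hatv1 else v1 in
  sscale (qdiff logq)^-1 (ssub (vertex (v true)) (vertex (v false))).

Definition pi1_H (i : 'I_2) (n : int) : H -> H :=
  oscl (if i == 0 then hath1 n else h1 n) n.

(* F(z) exp (- (q - q^{-1}) \sum_{n > 0} (1 - p^n)^{-1} H_n z^{-n}) *)
Definition dress (F : opser C) (Hn : int -> H -> H) (p : C) : opser C :=
  F ** sexp (sscale (- qdiff logq)
         (modeser (fun n => 0 < n) (fun n v => (1 - p ^ n)^-1 *: Hn n v))).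

Definition pi1_Fdress (i : 'I_2) (p : C) : opser C := dress (pi1_F i) (pi1_H i) p.

End Currents.

(* Main.v *)
Require Import Defs.
From HB Require Import structures.
From mathcomp Require Import all_boot all_order all_algebra finmap.
From mathcomp Require Import all_classical reals.
From mathcomp Require Import sequences exp trigo.
From mathcomp Require Import complex.
From mathcomp Require Import monalg.
From mathcomp Require Import ring.

(** Both identities hold current by current: for either sign, the vertex
operator of the screening field is the product of e^{+-s Qbar}, the vertex
operator of the current F_i, the dressing exponential and a power of z.

A vertex operator is a product of five factors: e^Q, the exponential of the
creation modes, z^L, e^B and the exponential of the annihilation modes.  The
three extra factors can each be absorbed into one of them.  On the left,
e^{+-s Qbar} meets e^Q.  On the right, the dressing contains annihilation modes
only; these commute among themselves, so its exponential multiplies the last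
factor by adding exponents ([vertex_annih]).  Zero modes commute with the
oscillators, so the final power of z moves left until it meets z^L
([vertex_zpowA]).  Hence the right-hand side is again a pair of vertex operators
([dressed_vertex_sub]), and it remains to compare two free fields component by
component ([vertex_r3], [vertex_t3]).  With b = q^{(k_3+2)n}, c = q^{(k_2+2)n}
and q^{k_1 n} = 1/(bc), which is where k_1 + k_2 + k_3 = -4 enters, the
oscillator components agree by a rational identity in q^n, b, c and n.  The
denominators are nonzero because |p_2|, |p_3| and |q| are smaller than 1.  The
zero modes agree by the choice of lambda; for tau_3 they agree modulo the
relations sum_i a_{i,0} = 0 and sum_i Q_{a_i} = 0.

The absorption steps need associativity of the product of operator-valued
series, which is given by finite-support sums and is not associative in general.
The factors z^L, e^B and the exponentials of annihilation modes send each vector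
to finitely many powers of z; such series form a semiring ([cfser]), in which
associativity and the binomial theorem are available.  The creation part is
not of this kind, but it only ever occurs as the leftmost factor, where
linearity of its coefficients suffices ([smulA]). *)

Set Implicit Arguments.
Unset Strict Implicit.
Unset Printing Implicit Defensive.

Import Order.TTheory GRing.Theory Num.Theory.
Local Open Scope ring_scope.

(** * Linear maps given as plain functions *)

Section LinearMaps.
Variables (A : nzRingType) (U V : lmodType A) (T : U -> V).
Hypothesis T_lin : linear T.

Let bundled : {linear U -> V} :=
  HB.pack T (GRing.isLinear.Build A U V *:%R T T_lin).

Lemma lin0 : T 0 = 0. Proof. exact: (linear0 bundled). Qed.

Lemma linD u v : T (u + v) = T u + T v. Proof. exact: (linearD bundled). Qed.

Lemma linZ c v : T (c *: v) = c *: T v.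
Proof. exact: (linearZ_LR bundled). Qed.

Lemma lin_sum (I : Type) (r : seq I) (F : I -> U) :
  T (\sum_(i <- r) F i) = \sum_(i <- r) T (F i).
Proof. exact: (linear_sum bundled). Qed.

End LinearMaps.

(** * Operator series with finite columns *)

Section ColumnFinite.
Variable A : fieldType.
Local Notation H := (fock A).
Local Notation opser := (opser A).
Implicit Types (X Y : opser) (v : H) (d : {fset A}).

Definition slinear X := forall g, linear (X g).

(** The coefficients of the series form the rows of a matrix whose columns are
indexed by vectors; only finiteness of the columns makes the product a finite
sum. *)
Definition colfin X := forall v, exists d, forall g, g \notin d -> X g v = 0.

Lemma smulE X Y d g v : slinear X -> (forall h, h \notin d -> Y h v = 0) ->
  (X ** Y) g v = \sum_(h <- d) X (g - h) (Y h v).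
Proof.
move=> linX Y0; rewrite /smul (fsbigTE d) // => h /Y0 ->.
by rewrite (lin0 (linX _)).
Qed.

Lemma slinear_smul X Y : slinear X -> slinear Y -> colfin Y -> slinear (X ** Y).
Proof.
move=> linX linY finY g c u v.
have [[d Yu] [d' Yv]] := (finY u, finY v).
have Yu' h : h \notin (d `|` d')%fset -> Y h u = 0.
  by rewrite in_fsetU negb_or => /andP[/Yu].
have Yv' h : h \notin (d `|` d')%fset -> Y h v = 0.
  by rewrite in_fsetU negb_or => /andP[_ /Yv].
rewrite !(@smulE X Y (d `|` d')%fset) // => [|h hd]; last first.
  by rewrite linY Yu' // Yv' // scaler0 addr0.
rewrite scaler_sumr -big_split; apply: eq_bigr => h _ /=.
by rewrite linY linX.
Qed.

(** For fixed [v], the series [X] is applied to finitely many vectors [Y h v],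
each of which has finitely many images. *)
Lemma colfin_smul X Y : slinear X -> colfin X -> colfin Y -> colfin (X ** Y).
Proof.
move=> linX finX finY v; have [d Y0] := finY v.
have [e Xe] := choice (fun h => finX (Y h v)).
exists (\bigcup_(h <- d) [fset (g + h)%R | g in e h])%fset => g gD.
rewrite (smulE _ linX Y0) big_seq big1 // => h hd; apply: Xe.
apply: contra gD => ghe; apply/bigfcupP; exists h; first by rewrite hd.
by apply/imfsetP; exists (g - h) => //; rewrite subrK.
Qed.

(** Finite columns of [Y] and [Z] make both sides the sum of the
[X (g - k - h) (Y k (Z h v))] over a finite set of pairs [(h, k)]; linearity of
[X] takes it through the inner sum. *)
Lemma smulA X Y Z : slinear X -> slinear Y -> colfin Y -> colfin Z ->
  X ** (Y ** Z) = X ** Y ** Z.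
Proof.
move=> linX linY finY finZ; apply/funext => g; apply/funext => v.
have [d Z0] := finZ v.
have [D YZ0] := colfin_smul linY finY finZ v.
have [e Ye] := choice (fun h => finY (Z h v)).
pose E := (\bigcup_(h <- d) e h)%fset.
have EY h k : h \in d -> k \notin E -> Y k (Z h v) = 0.
  move=> hd kE; apply: Ye; apply: contra kE => kE.
  by apply/bigfcupP; exists h; rewrite ?hd.
rewrite [RHS](smulE _ _ Z0); last exact: slinear_smul.
pose D' := (D `|` [fset (k + h)%R | h in d, k in E])%fset.
rewrite (@smulE _ _ D') //; last first.
  by move=> h; rewrite inE negb_or => /andP[/YZ0].
under eq_bigr do rewrite (smulE _ linY Z0) (lin_sum (linX _)).
rewrite exchange_big /= big_seq [RHS]big_seq; apply: eq_bigr => h hd.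
have Ysupp k : k \notin E -> Y k (Z h v) = 0 by exact: EY.
rewrite (smulE _ linX Ysupp).
(* Only the exponents k + h with k in E contribute to the sum over D'. *)
rewrite -(@big_fset_incl _ _ _ _ [fset (k + h)%R | k in E]%fset D') /=;
  first last.
- move=> k _ kE; rewrite EY ?(lin0 (linX _)) //; apply: contra kE => kE.
  by apply/imfsetP; exists (k - h); rewrite ?subrK.
- apply/fsubsetP => x /imfsetP[k /= kE ->]; rewrite inE; apply/orP; right.
  by apply/imfset2P; exists h => //; exists k.
rewrite big_imfset /=; last by move=> x y _ _ /addIr.
by apply: eq_bigr => k _; rewrite addrK opprD addrA addrAC.
Qed.

Lemma slinear_sadd X Y : slinear X -> slinear Y -> slinear (sadd X Y).
Proof.
move=> lX lY g c u v; rewrite /sadd lX lY scalerDr -!addrA; congr (_ + _).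
by rewrite addrCA.
Qed.

Lemma slinear_sscale c X : slinear X -> slinear (sscale c X).
Proof. by move=> lX g b u v; rewrite /sscale lX scalerDr !scalerA mulrC. Qed.

Lemma colfin_sadd X Y : colfin X -> colfin Y -> colfin (sadd X Y).
Proof.
move=> fX fY v; have [[d Xv] [d' Yv]] := (fX v, fY v).
exists (d `|` d')%fset => g; rewrite inE negb_or /sadd => /andP[/Xv -> /Yv ->].
by rewrite addr0.
Qed.

Lemma smulDl X Y Z : slinear X -> slinear Y -> colfin Z ->
  sadd X Y ** Z = sadd (X ** Z) (Y ** Z).
Proof.
move=> lX lY fZ; apply/funext => g; apply/funext => v; rewrite {2}/sadd.
have [d Zv] := fZ v; have lXY := slinear_sadd lX lY.
by rewrite !(@smulE _ _ d) // -big_split.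
Qed.

Lemma smulZl c X Z : slinear X -> colfin Z ->
  sscale c X ** Z = sscale c (X ** Z).
Proof.
move=> lX fZ; apply/funext => g; apply/funext => v; rewrite {2}/sscale.
have [d Zv] := fZ v; have lcX := slinear_sscale c lX.
by rewrite !(@smulE _ _ d) // scaler_sumr.
Qed.

Lemma smul_sscale_ssub c X Y Z : slinear X -> slinear Y -> colfin Z ->
  sscale c (ssub X Y) ** Z = sscale c (ssub (X ** Z) (Y ** Z)).
Proof.
move=> lX lY fZ; have lNY := slinear_sscale (-1) lY.
rewrite /ssub (smulZl _ (slinear_sadd lX lNY) fZ) (smulDl lX lNY fZ).
by rewrite (smulZl _ lY fZ).
Qed.

Lemma smulDr X Y Z : slinear X -> colfin Y -> colfin Z ->
  X ** sadd Y Z = sadd (X ** Y) (X ** Z).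
Proof.
move=> lX fY fZ; apply/funext => g; apply/funext => v; rewrite {2}/sadd.
have [[d Yv] [d' Zv]] := (fY v, fZ v).
have Yv' h : h \notin (d `|` d')%fset -> Y h v = 0.
  by rewrite in_fsetU negb_or => /andP[/Yv].
have Zv' h : h \notin (d `|` d')%fset -> Z h v = 0.
  by rewrite in_fsetU negb_or => /andP[_ /Zv].
rewrite !(@smulE _ _ (d `|` d')%fset) //; last first.
  by move=> h hd; rewrite /sadd Yv' ?Zv' ?addr0.
by rewrite -big_split; apply: eq_bigr => h _; rewrite /sadd (linD (lX _)).
Qed.

Lemma sconst_mul (T : H -> H) X g v : linear T ->
  (sconst T ** X) g v = T (X g v).
Proof.
move=> lT; rewrite /smul (fsbigTE [fset g]%fset).
  by rewrite big_seq_fset1 /sconst subrr eqxx.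
by move=> h; rewrite inE /sconst subr_eq0 eq_sym => /negPf ->.
Qed.

Lemma sconst_sscale_ssub c (T : H -> H) X Y : linear T ->
  sconst T ** sscale c (ssub X Y)
  = sscale c (ssub (sconst T ** X) (sconst T ** Y)).
Proof.
move=> lT; apply/funext => g; apply/funext => v.
rewrite sconst_mul // /sscale /ssub /sadd /sscale !(sconst_mul _ _ _ lT).
by rewrite (linZ lT) (linD lT) (linZ lT).
Qed.

Lemma smul_const X (T : H -> H) g v : slinear X ->
  (X ** sconst T) g v = X g (T v).
Proof.
move=> lX; rewrite (@smulE _ _ [fset 0]%fset) //.
  by rewrite big_seq_fset1 /sconst eqxx subr0.
by move=> h; rewrite inE /sconst => /negPf ->.
Qed.

Lemma slinear_sconst (T : H -> H) : linear T -> slinear (sconst T).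
Proof.
move=> lT g c u v; rewrite /sconst.
by case: ifP => _; [exact: lT|rewrite scaler0 addr0].
Qed.

Lemma colfin_sconst (T : H -> H) : colfin (sconst T).
Proof.
by move=> v; exists [fset 0]%fset => g; rewrite inE /sconst => /negPf ->.
Qed.

(** Bundling makes these series a semiring, to which the binomial theorem for
commuting elements applies. *)
Record cfser := CFSer {
  cf :> opser; cf_lin : slinear cf; cf_fin : colfin cf }.

HB.instance Definition _ := gen_eqMixin cfser.
HB.instance Definition _ := gen_choiceMixin cfser.

Lemma cfserP (x y : cfser) : cf x = cf y -> x = y.
Proof.
case: x y => [X lX fX] [Y lY fY] /= eqXY; case: Y / eqXY in lY fY *.
by congr CFSer; exact: Prop_irrelevance.
Qed.

Fact lin_id : linear (@id H). Proof. by []. Qed.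

Fact slinear0 : slinear (fun=> fun=> 0).
Proof. by move=> g c u v; rewrite scaler0 addr0. Qed.

Fact colfin0 : colfin (fun=> fun=> 0).
Proof. by move=> v; exists fset0. Qed.

Definition cf0 := CFSer slinear0 colfin0.
Definition cf1 := CFSer (slinear_sconst lin_id) (colfin_sconst id).
Definition cfadd (x y : cfser) :=
  CFSer (slinear_sadd (cf_lin x) (cf_lin y))
        (colfin_sadd (cf_fin x) (cf_fin y)).
Definition cfmul (x y : cfser) :=
  CFSer (slinear_smul (cf_lin x) (cf_lin y) (@cf_fin y))
        (colfin_smul (cf_lin x) (@cf_fin x) (@cf_fin y)).

Fact cfaddA : associative cfadd.
Proof.
by move=> x y z; apply: cfserP; do 2!apply/funext => ?; rewrite /= /sadd addrA.
Qed.

Fact cfaddC : commutative cfadd.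
Proof.
by move=> x y; apply: cfserP; do 2!apply/funext => ?; rewrite /= /sadd addrC.
Qed.

Fact cfadd0 : left_id cf0 cfadd.
Proof.
by move=> x; apply: cfserP; do 2!apply/funext => ?; rewrite /= /sadd add0r.
Qed.

Fact cfmulA : associative cfmul.
Proof.
move=> x y z; apply: cfserP; apply: smulA;
  first [exact: cf_lin | exact: cf_fin].
Qed.

Fact cfmul1 : left_id cf1 cfmul.
Proof.
by move=> x; apply: cfserP; do 2!apply/funext => ?; rewrite /= sconst_mul.
Qed.

Fact cfmulr1 : right_id cf1 cfmul.
Proof.
move=> x; apply: cfserP; do 2!apply/funext => ?.
by rewrite /= smul_const //; apply: cf_lin.
Qed.

Fact cfmulDl : left_distributive cfmul cfadd.
Proof.
move=> x y z; apply: cfserP; apply: smulDl;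
  first [exact: cf_lin | exact: cf_fin].
Qed.

Fact cfmulDr : right_distributive cfmul cfadd.
Proof.
move=> x y z; apply: cfserP; apply: smulDr;
  first [exact: cf_lin | exact: cf_fin].
Qed.

Fact cfmul0l : left_zero cf0 cfmul.
Proof.
move=> x; apply: cfserP; do 2!apply/funext => ?.
by rewrite /= /smul fsbig1.
Qed.

Fact cfmul0r : right_zero cf0 cfmul.
Proof.
move=> x; apply: cfserP; do 2!apply/funext => ?.
by rewrite /= /smul fsbig1 // => h _; rewrite (lin0 (@cf_lin x _)).
Qed.

HB.instance Definition _ := GRing.isPzSemiRing.Build cfser
  cfaddA cfaddC cfadd0 cfmulA cfmul1 cfmulr1 cfmulDl cfmulDr cfmul0l cfmul0r.

Lemma cfM (x y : cfser) : cf (x * y) = cf x ** cf y. Proof. by []. Qed.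

Lemma cfD (x y : cfser) : cf (x + y) = sadd (cf x) (cf y). Proof. by []. Qed.

Lemma cfX (x : cfser) m : cf (x ^+ m) = spow (cf x) m.
Proof. by elim: m => [|m IHm] //; rewrite exprS cfM IHm. Qed.

Lemma cfMn (x : cfser) n g v : cf (x *+ n) g v = cf x g v *+ n.
Proof. by elim: n => [|n IHn] //; rewrite !mulrS cfD /sadd IHn. Qed.

Lemma cf_sum (I : Type) (r : seq I) (F : I -> cfser) g v :
  cf (\sum_(i <- r) F i) g v = \sum_(i <- r) cf (F i) g v.
Proof.
by elim: r => [|i r IHr]; rewrite ?big_nil ?big_cons // cfD /sadd IHr.
Qed.

(** The form of associativity in which an arbitrary linear series stands on the
left, such as one that contains creation modes. *)
Lemma smul_cfM X (x y : cfser) : slinear X ->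
  X ** cf x ** cf y = X ** cf (x * y).
Proof.
by move=> lX; rewrite cfM smulA //; [exact: cf_lin|exact: cf_fin|exact: cf_fin].
Qed.

(** Coefficientwise commutation is enough, since exchanging the factors only
reindexes the defining sum along [h |-> g - h]. *)
Lemma smulC X Y : (forall g h v, X g (Y h v) = Y h (X g v)) -> X ** Y = Y ** X.
Proof.
move=> XY; apply/funext => g; apply/funext => v; rewrite /smul.
rewrite (@reindex_fsbigT _ _ _ _ _ (fun h => g - h)); last first.
  by exists (fun h => g - h) => h; rewrite opprB addrC subrK.
by apply: eq_fsbigr => h _; rewrite opprB addrC subrK XY.
Qed.

End ColumnFinite.

(** * Degree in the creation modes *)

Section Degree.
Variable A : fieldType.
Local Notation H := (fock A).
Implicit Types (v : H) (n : nat).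

Lemma fock_sum v : v = \sum_(b <- msupp v) v@_b *: fvec b.1 b.2.
Proof.
rewrite [LHS]monalgE; apply: eq_bigr => -[m beta] _.
by rewrite malgUZ unlock.
Qed.

Lemma lin_ext (T T' : H -> H) : linear T -> linear T' ->
  (forall m beta, T (fvec m beta) = T' (fvec m beta)) -> T =1 T'.
Proof.
move=> lT lT' TT' v; rewrite [v]fock_sum !(lin_sum lT, lin_sum lT').
by apply: eq_bigr => b _; rewrite (linZ lT) (linZ lT') TT'.
Qed.

(** A strict bound, so that [deglt 0] characterizes the zero vector; this makes
a series that lowers the degree locally nilpotent. *)
Definition deglt n v := forall b, b \in msupp v -> (mdeg b.1 < n)%N.

Lemma deglt0 v : deglt 0 v -> v = 0.
Proof.
move=> v0; apply/malgP => b; rewrite mcoeff0.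
by apply/mcoeff_outdom/negP => /v0.
Qed.

Lemma deglt_leq n n' v : (n <= n')%N -> deglt n v -> deglt n' v.
Proof. by move=> nn' vn b /vn /leq_trans; apply. Qed.

Lemma deglt_exists v : exists n, deglt n v.
Proof.
exists (\max_(b <- msupp v) (mdeg b.1).+1)%N => b bv.
by apply: (@leq_bigmax_seq _ _ xpredT (fun b : fbasis A => (mdeg b.1).+1)).
Qed.

Lemma deglt_zero n : deglt n 0.
Proof. by move=> b; rewrite msupp0 inE. Qed.

Lemma degltD n u v : deglt n u -> deglt n v -> deglt n (u + v).
Proof.
move=> un vn b /(fsubsetP (msuppD_le _ _)).
by rewrite inE => /orP[/un|/vn].
Qed.

Lemma degltZ n c v : deglt n v -> deglt n (c *: v).
Proof. by move=> vn b /(fsubsetP (msuppZ_le _ _)) /vn. Qed.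

Lemma deglt_sum n (I : eqType) (r : seq I) (F : I -> H) :
  (forall i, i \in r -> deglt n (F i)) -> deglt n (\sum_(i <- r) F i).
Proof.
move=> Fn; rewrite big_seq; elim/big_ind: _ => //; first exact: deglt_zero.
exact: degltD.
Qed.

Lemma deglt_fvec n m beta : (mdeg m < n)%N -> deglt n (fvec m beta : H).
Proof.
by move=> mn b; rewrite unlock => /(fsubsetP msuppU_le); rewrite inE => /eqP ->.
Qed.

Definition lowers (k : nat) (X : opser A) :=
  forall n g v, deglt n v -> deglt (n - k) (X g v).

Lemma lowers_smul j k (X Y : opser A) : slinear X -> colfin Y ->
  lowers j X -> lowers k Y -> lowers (j + k) (X ** Y).
Proof.
move=> lX fY Xj Yk n g v vn; have [d Yv] := fY v.
rewrite (smulE _ lX Yv); apply: deglt_sum => h _.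
by rewrite addnC subnDA; apply/Xj/Yk.
Qed.

Lemma lowersX (x : cfser A) m : lowers 1 x -> lowers m (x ^+ m).
Proof.
move=> x1; elim: m => [|m IHm].
  move=> n g v vn; rewrite subn0 expr0 /= /sconst.
  by case: ifP => _; [exact: vn|exact: deglt_zero].
rewrite exprS -[m.+1]add1n; apply: lowers_smul => //; first exact: cf_lin.
exact: cf_fin.
Qed.

End Degree.

(** * Exponentials of locally nilpotent series *)

Section Exponentials.
Variable A : numFieldType.
Local Notation H := (fock A).
Implicit Types (x y : cfser A) (v : H).

Lemma fsum_nat d (F : nat -> H) : (forall m, (d <= m)%N -> F m = 0) ->
  \sum_(m \in [set: nat]) F m = \sum_(m < d) F m.
Proof.
move=> F0; rewrite fsbig_ord; apply/esym/fsbig_widen => // m [_ /negP].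
by rewrite -leqNgt => /F0.
Qed.

(** On a vector of degree less than [d] the [d]-th power of a series lowering
the degree vanishes, so its exponential is a finite sum. *)
Lemma sexp_lowersE x d g v : lowers 1 x -> deglt d v ->
  sexp x g v = \sum_(m < d) (m`!%:R : A)^-1 *: cf (x ^+ m) g v.
Proof.
move=> x1 vd; rewrite /sexp (@fsum_nat d) => [|m dm].
  by apply: eq_bigr => m _; rewrite cfX.
rewrite -cfX [cf _ _ _]deglt0 ?scaler0 //.
by have := lowersX (m := m) x1 (g := g) vd; move/eqP: dm => ->.
Qed.

Lemma slinear_sexp x : lowers 1 x -> slinear (sexp x).
Proof.
move=> x1 g c u v; have [[d ud] [d' vd]] := (deglt_exists u, deglt_exists v).
have uD := deglt_leq (leq_maxl d d') ud.
have vD := deglt_leq (leq_maxr d d') vd.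
rewrite !(@sexp_lowersE x (maxn d d')) //; last first.
  by apply/degltD => //; exact: degltZ.
rewrite scaler_sumr -big_split; apply: eq_bigr => m _ /=.
by rewrite cf_lin scalerDr !scalerA mulrC.
Qed.

Lemma colfin_sexp x : lowers 1 x -> colfin (sexp x).
Proof.
move=> x1 v; have [d vd] := deglt_exists v.
have [e xe] := choice (fun m => cf_fin (x ^+ m) v).
exists (\bigcup_(m <- iota 0 d) e m)%fset => g ge.
rewrite (sexp_lowersE _ x1 vd) big1 // => m _; rewrite xe ?scaler0 //.
apply: contra ge => gm; apply/bigfcupP; exists (m : nat) => //.
by rewrite mem_iota ltn_ord.
Qed.

Definition cfexp x (x1 : lowers 1 x) : cfser A :=
  CFSer (slinear_sexp x1) (colfin_sexp x1).

(** Summation by antidiagonals [m + n = N] agrees with summation over a square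
when all terms beyond the antidiagonals [N < d] vanish. *)
Lemma sum_triangle d (F : nat -> nat -> H) :
  (forall m n, (d <= m + n)%N -> F m n = 0) ->
  \sum_(N < d) \sum_(i < N.+1) F (N - i)%N i = \sum_(n < d) \sum_(m < d) F m n.
Proof.
move=> F0.
pose G N i := if (i <= N)%N then F (N - i)%N i else 0.
transitivity (\sum_(N < d) \sum_(i < d) G N i).
  apply: eq_bigr => N _.
  rewrite (big_ord_widen _ (fun i => F (N - i)%N i) (ltn_ord N)).
  by rewrite big_mkcond; apply: eq_bigr => i _; rewrite /G ltnS.
rewrite exchange_big; apply: eq_bigr => i _ /=.
rewrite -(big_mkord xpredT (fun N => G N i)).
rewrite -(big_mkord xpredT (fun m => F m i)) /=.
rewrite (big_cat_nat (leq0n i) (ltnW (ltn_ord i))) /= big_nat big1 ?add0r;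
  last first.
  by move=> N /andP[_ Ni]; rewrite /G leqNgt Ni.
rewrite [RHS](big_cat_nat (leq0n (d - i)) (leq_subr i d)) /=.
rewrite [X in _ = _ + X]big_nat [X in _ = _ + X]big1 ?addr0; last first.
  by move=> m /andP[dm _]; rewrite F0 // addnC -leq_subLR.
rewrite -{1}[nat_of_ord i]add0n big_addn; apply: eq_bigr => m _.
by rewrite /G leq_addl addnK.
Qed.

(** The usual proof of exp (x + y) = exp x exp y: on a vector of degree less
than [d] the products [x ^ m y ^ n] with [d <= m + n] vanish, so the binomial
expansion of the left-hand side and the square of terms on the right-hand side
have the same nonzero terms. *)
Lemma sexpD x y : lowers 1 x -> lowers 1 y -> GRing.comm x y ->
  sexp (x + y) = sexp x ** sexp y.
Proof.
move=> x1 y1 xy; apply/funext => g; apply/funext => v.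
have [d vd] := deglt_exists v.
have xy1 : lowers 1 (x + y).
  by move=> n h w wn; apply: degltD; [exact: x1|exact: y1].
have [e ye] := choice (fun m => cf_fin (y ^+ m) v).
pose D := (\bigcup_(m <- iota 0 d) e m)%fset.
have yD (n : 'I_d) h : h \notin D -> cf (y ^+ n) h v = 0.
  move=> hD; rewrite ye //; apply: contra hD => hn; apply/bigfcupP.
  by exists (n : nat) => //; rewrite mem_iota ltn_ord.
pose F m n := (m`!%:R * n`!%:R : A)^-1 *: cf (x ^+ m * y ^+ n) g v.
rewrite (sexp_lowersE _ xy1 vd).
transitivity (\sum_(N < d) \sum_(i < N.+1) F (N - i)%N i).
  apply: eq_bigr => N _; rewrite (exprDn_comm _ xy) cf_sum scaler_sumr.
  apply: eq_bigr => i _; rewrite cfMn -scaler_nat scalerA /F.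
  apply: (congr1 (fun t : A => t *: _)).
  have iN : (i <= N)%N by rewrite -ltnS.
  have binE := congr1 (fun t : nat => t%:R : A) (bin_fact iN).
  have f0 n : n`!%:R != 0 :> A by rewrite pnatr_eq0 -lt0n fact_gt0.
  apply: (mulfI (f0 N)); rewrite mulrA divff // mul1r.
  apply: (mulIf (mulf_neq0 (f0 (N - i)%N) (f0 i))).
  rewrite mulfVK ?mulf_neq0 // -binE -!natrM.
  by apply: (congr1 (fun t : nat => t%:R : A)); rewrite [(i`! * _)%N]mulnC.
rewrite sum_triangle => [|m n dmn]; last first.
  rewrite /F [cf _ _ _]deglt0 ?scaler0 //.
  have := lowers_smul (cf_lin (x ^+ m)) (@cf_fin _ (y ^+ n))
    (lowersX x1) (lowersX y1) (g := g) vd.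
  by move/eqP: dmn => ->.
have sy0 h : h \notin D -> sexp y h v = 0.
  move=> hD; rewrite (sexp_lowersE _ y1 vd) big1 // => n _.
  by rewrite yD ?scaler0.
rewrite (smulE _ (slinear_sexp x1) sy0).
transitivity (\sum_(h <- D) \sum_(n < d) \sum_(m < d)
   (m`!%:R * n`!%:R : A)^-1 *: cf (x ^+ m) (g - h) (cf (y ^+ n) h v)).
  rewrite [RHS]exchange_big; apply: eq_bigr => n _; rewrite [RHS]exchange_big.
  apply: eq_bigr => m _ /=; rewrite /F cfM (smulE _ (cf_lin _) (yD n)).
  by rewrite scaler_sumr.
apply: eq_bigr => h _; rewrite (sexp_lowersE _ y1 vd).
rewrite (lin_sum (slinear_sexp x1 _)).
apply: eq_bigr => n _; rewrite (linZ (slinear_sexp x1 _)).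
rewrite (@sexp_lowersE _ d) // ?scaler_sumr; last first.
  exact/(deglt_leq (leq_subr n d))/(lowersX y1).
by apply: eq_bigr => m _; rewrite scalerA -invfM [in LHS]mulrC.
Qed.

Definition scomm (T : H -> H) (X : opser A) :=
  forall g v, X g (T v) = T (X g v).

Lemma scomm_mul (T : H -> H) x y : linear T -> scomm T x -> scomm T y ->
  scomm T (cf (x * y)).
Proof.
move=> lT Tx Ty g v; have [d yd] := cf_fin y v.
rewrite cfM !(@smulE _ _ _ d) //; try exact: cf_lin; last first.
  by move=> h hd; rewrite Ty yd // (lin0 lT).
by rewrite (lin_sum lT); apply: eq_bigr => h _; rewrite Ty Tx.
Qed.

Lemma scomm_sexp (T : H -> H) x : linear T -> lowers 1 x -> scomm T x ->
  scomm T (sexp x).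
Proof.
move=> lT x1 Tx g v.
have [[d vd] [d' Td]] := (deglt_exists v, deglt_exists (T v)).
have vD := deglt_leq (leq_maxl d d') vd.
have TD := deglt_leq (leq_maxr d d') Td.
rewrite !(@sexp_lowersE x (maxn d d')) // (lin_sum lT); apply: eq_bigr => m _.
rewrite (linZ lT); congr (_ *: _).
suff: scomm T (x ^+ m) by exact.
elim: {m}(m : nat) => [|m IHm]; last by rewrite exprS; exact: scomm_mul.
by move=> h w; rewrite expr0 /= /sconst; case: ifP => // _; rewrite (lin0 lT).
Qed.

(** The exponents of a series of creation modes are positive integers; this
replaces finiteness of columns, because a natural number has finitely many
decompositions as a sum of natural numbers. *)
Definition raises (k : nat) (X : opser A) :=
  forall g v, (forall n, (k <= n)%N -> g != n%:R) -> X g v = 0.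

(** The bound [d] on the summation depends on [g] alone, hence not on the
vector, which is what linearity of the product requires. *)
Lemma raises_smulE (g : A) : exists d : {fset A}, forall X Y v,
  slinear X -> raises 0 X -> raises 0 Y ->
  (X ** Y) g v = \sum_(h <- d) X (g - h) (Y h v).
Proof.
have [[N gN]|gN] := pselect (exists N : nat, g = N%:R); last first.
  exists fset0 => X Y v lX X0 Y0; rewrite /smul (fsbigTE fset0) // => h _.
  have [[n hn]|hn] := pselect (exists n : nat, h = n%:R).
    rewrite X0 // => m _; apply/eqP => ghm; apply: gN; exists (m + n)%N.
    by rewrite natrD -ghm hn subrK.
  rewrite Y0 ?(lin0 (lX _)) // => n _; apply/eqP => hn'.
  by apply: hn; exists n.
exists [fset (i%:R : A) | i in iota 0 N.+1]%fset => X Y v lX X0 Y0.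
rewrite /smul (fsbigTE [fset (i%:R : A) | i in iota 0 N.+1]%fset) // => h hd.
have [[n hn]|hn] := pselect (exists n : nat, h = n%:R).
  rewrite X0 // => m _; apply/eqP => ghm; case/negP: hd; apply/imfsetP.
  exists n => //; rewrite mem_iota leq0n add0n ltnS.
  rewrite -(ler_nat A) -gN -hn -subr_ge0 ghm; exact: ler0n.
rewrite Y0 ?(lin0 (lX _)) // => n _; apply/eqP => hn'.
  by apply: hn; exists n.
Qed.

Lemma raises_leq j k X : (j <= k)%N -> raises k X -> raises j X.
Proof. by move=> jk Xk g v gj; apply: Xk => n kn; apply/gj/(leq_trans jk). Qed.

Lemma raises_smul j k X Y : slinear X -> raises j X -> raises k Y ->
  raises (j + k) (X ** Y).
Proof.
move=> lX Xj Yk g v gjk; rewrite /smul fsbig1 // => h _.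
have [[n kn hn]|hn] := pselect (exists2 n : nat, (k <= n)%N & h = n%:R);
  last first.
  rewrite Yk ?(lin0 (lX _)) // => n kn; apply/eqP => hn'.
  by apply: hn; exists n.
rewrite Xj // => m jm; apply/eqP => ghm.
have /eqP[] := gjk (m + n)%N (leq_add jm kn).
by rewrite natrD -ghm hn subrK.
Qed.

Lemma slinear_raises_smul X Y : slinear X -> slinear Y -> raises 0 X ->
  raises 0 Y -> slinear (X ** Y).
Proof.
move=> lX lY X0 Y0 g c u v; have [d dE] := raises_smulE g.
rewrite !dE // scaler_sumr -big_split; apply: eq_bigr => h _ /=.
by rewrite lY lX.
Qed.

Lemma raises_spow X m : slinear X -> raises 1 X ->
  slinear (spow X m) /\ raises m (spow X m).
Proof.
move=> lX X1; elim: m => [|m [lm Xm]].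
  split=> [|g v g0]; first exact/slinear_sconst/lin_id.
  by rewrite /= /sconst (negPf (g0 0%N _)).
split; last by rewrite -[m.+1]add1n; exact: raises_smul.
apply: slinear_raises_smul => //.
  exact: raises_leq X1.
exact: raises_leq Xm.
Qed.

(** Each coefficient of the exponential is a finite sum of powers: the
coefficient of z^N in [X ^ m] vanishes for [N < m]. *)
Lemma slinear_raises_sexp X : slinear X -> raises 1 X -> slinear (sexp X).
Proof.
move=> lX X1 g c u v; have pX m := raises_spow m lX X1.
have [N gN] : exists N, forall m w, (N <= m)%N -> spow X m g w = 0.
  have [[N gN]|gN] := pselect (exists N : nat, g = N%:R).
    exists N.+1 => m w Nm; apply: (pX m).2 => n mn.
    by rewrite gN eqr_nat neq_ltn (leq_trans Nm mn).
  exists 0%N => m w _; apply: (pX m).2 => n mn; apply/eqP => gn; apply: gN.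
  by exists n.
have sE w : sexp X g w = \sum_(m < N) (m`!%:R : A)^-1 *: spow X m g w.
  by apply: fsum_nat => m Nm; rewrite gN ?scaler0.
rewrite !sE.
rewrite scaler_sumr -big_split; apply: eq_bigr => m _ /=.
by rewrite (pX m).1 scalerDr !scalerA mulrC.
Qed.

End Exponentials.

(** * Modes and vertex operators *)

Section Vertex.
Variable A : numFieldType.
Variable gram : int -> 'I_4 -> 'I_4 -> A.
Variable ex : A -> A.
Local Notation H := (fock A).
Local Notation osc := (osc gram).
Local Notation oscl := (oscl gram).
Local Notation zpair := (zpair gram).
Local Notation zpowA := (zpowA gram).
Local Notation expA := (expA gram ex).
Local Notation vertex := (vertex gram ex).
Implicit Types (v : H) (c : 'rV[A]_4) (o : int -> 'rV[A]_4).

Lemma modeserE (P : pred int) (T : int -> H -> H) n v :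
  P n -> modeser P T (- n)%:~R v = T n v.
Proof.
move=> Pn; rewrite /modeser [X in \sum_(_ \in X) _](_ : _ = [set n]%classic).
  by rewrite fsbig_set1.
apply/seteqP; split=> [k /= [_ /eqP]|k -> //].
by rewrite eqr_int eqr_opp => /eqP.
Qed.

Lemma modeser0 (P : pred int) (T : int -> H -> H) g v :
  (forall n, P n -> (- n)%:~R != g) -> modeser P T g v = 0.
Proof.
move=> Pg; rewrite /modeser fsbig1 // => n [Pn gn].
by have := Pg n Pn; rewrite gn eqxx.
Qed.

(** In characteristic zero an exponent comes from at most one mode, so a mode
series is determined by this dichotomy together with [modeserE] and
[modeser0]. *)
Lemma modeser_supp (P : pred int) (g : A) :
  (exists2 n, P n & g = (- n)%:~R) \/ (forall n, P n -> (- n)%:~R != g).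
Proof.
have [[n Pn gn]|Pg] := pselect (exists2 n, P n & g = (- n)%:~R).
  by left; exists n.
by right=> n Pn; apply/eqP => gn; apply: Pg; exists n.
Qed.

Lemma eq_modeser (P : pred int) (T T' : int -> H -> H) :
  (forall n v, P n -> T n v = T' n v) -> modeser P T = modeser P T'.
Proof.
move=> TT'; apply/funext => g; apply/funext => v.
have [[n Pn ->]|Pg] := modeser_supp P g; first by rewrite !modeserE // TT'.
by rewrite !modeser0.
Qed.

Lemma slinear_modeser (P : pred int) (T : int -> H -> H) :
  (forall n, linear (T n)) -> slinear (modeser P T).
Proof.
move=> lT g c u v.
have [[n Pn ->]|Pg] := modeser_supp P g; first by rewrite !modeserE // lT.
by rewrite !modeser0 // scaler0 addr0.
Qed.

Lemma linear_osc i n : linear (osc i n).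
Proof. exact: flin_is_linear. Qed.

Lemma linear_oscl c n : linear (oscl c n).
Proof.
move=> a u v; rewrite /oscl scaler_sumr -big_split; apply: eq_bigr => i _ /=.
by rewrite linearP scalerDr !scalerA mulrC.
Qed.

Lemma osclD c c' n v : oscl (c + c') n v = oscl c n v + oscl c' n v.
Proof.
by rewrite /oscl -big_split; apply: eq_bigr => i _; rewrite /= mxE scalerDl.
Qed.

Lemma osclZ a c n v : oscl (a *: c) n v = a *: oscl c n v.
Proof.
by rewrite /oscl scaler_sumr; apply: eq_bigr => i _; rewrite mxE scalerA.
Qed.

Lemma oscl_oscl c c' n n' v : oscl c n (oscl c' n' v)
  = \sum_(i < 4) \sum_(j < 4) (c 0 i * c' 0 j) *: osc i n (osc j n' v).
Proof.
apply: eq_bigr => i _; rewrite (lin_sum (linear_osc i n)) scaler_sumr.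
by apply: eq_bigr => j _; rewrite oscZ scalerA.
Qed.

Definition annih o := modeser (fun n => 0 < n) (fun n => oscl (o n) n).
Definition creat o := modeser (fun n => n < 0) (fun n => oscl (o n) n).

Lemma annihE o (p : nat) v : annih o (- p.+1%:Z)%:~R v = oscl (o p.+1) p.+1 v.
Proof. exact: modeserE. Qed.

Lemma annih_supp (g : A) :
  (exists p : nat, g = (- p.+1%:Z)%:~R) \/ (forall o v, annih o g v = 0).
Proof.
have [[[[|p]|p] // _ ->]|Pg] := modeser_supp (fun n => 0 < n) g.
  by left; exists p.
by right=> o v; exact: modeser0.
Qed.

Lemma slinear_annih o : slinear (annih o).
Proof. by apply: slinear_modeser => n; exact: linear_oscl. Qed.

Lemma raises_creat o : raises 1 (creat o).
Proof.
move=> g v g1; apply: modeser0 => -[n|n] // _.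
by rewrite NegzE opprK eq_sym g1.
Qed.

Lemma slinear_creat o : slinear (creat o).
Proof. by apply: slinear_modeser => n; exact: linear_oscl. Qed.

Lemma mdeg_divcm (m : {cmonom creation}) x : (0 < m x)%N ->
  mdeg m = (mdeg (divcm m (ucm x))).+1.
Proof.
move=> mx; have {1}-> : m = mulcm (ucm x) (divcm m (ucm x)).
  apply/eqP/cmP => y; rewrite mulcmE divcmE cmU subnKC //.
  by case: eqVneq => [<-|].
by rewrite (mdegM (ucm x)) mdegU.
Qed.

Lemma deglt_osc i (p : nat) n v : deglt n v -> deglt (n - 1) (osc i p.+1 v).
Proof.
move=> vn; rewrite [v]fock_sum (lin_sum (linear_osc _ _)).
apply: deglt_sum => b /vn bn.
rewrite oscZ; apply: degltZ; rewrite oscSE.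
apply: deglt_sum => j _.
have [->|m0] := posnP (b.1 (j, p)).
  by rewrite mulr0 scale0r; exact: deglt_zero.
apply/degltZ/deglt_fvec; rewrite subn1 -ltnS -mdeg_divcm //.
by rewrite (ltn_predK bn).
Qed.

Lemma lowers_annih o : lowers 1 (annih o).
Proof.
move=> n g v vn; have [[p ->]|g0] := annih_supp g; last first.
  by rewrite g0; exact: deglt_zero.
by rewrite annihE; apply: deglt_sum => i _; exact/degltZ/deglt_osc.
Qed.

(** A vector involves finitely many creation modes, and a_{i,n} with n > 0 only
pairs with the a_{j,-n}. *)
Lemma osc_eventually0 v :
  exists N, forall i (p : nat), (N <= p)%N -> osc i p.+1 v = 0.
Proof.
pose W (m : {cmonom creation}) := (\max_(x <- finsupp m) x.2.+1)%N.
exists (\max_(b <- msupp v) W b.1)%N => i p Np.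
rewrite [v]fock_sum (lin_sum (linear_osc _ _)) big_seq big1 //= => b bv.
rewrite oscZ oscSE big1 ?scaler0 // => j _.
suff -> : b.1 (j, p) = 0%N by rewrite mulr0 scale0r.
apply/eqP; rewrite -[_ == _]negbK -mem_finsupp; apply/negP => jp.
have : (p < W b.1)%N.
  exact: (@leq_bigmax_seq _ _ xpredT (fun x : creation => x.2.+1) (j, p)).
rewrite ltnNge; apply/negP; rewrite negbK; apply: leq_trans Np.
exact: (@leq_bigmax_seq _ _ xpredT (fun b : fbasis A => W b.1) b).
Qed.

Lemma colfin_annih o : colfin (annih o).
Proof.
move=> v; have [N vN] := osc_eventually0 v.
exists [fset ((- p.+1%:Z)%:~R : A) | p in iota 0 N]%fset => g gN.
have [[p gp]|g0] := annih_supp g; last exact: g0.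
rewrite gp annihE /Defs.oscl big1 // => i _.
rewrite vN ?scaler0 // leqNgt; apply: contra gN => pN.
by apply/imfsetP; exists p; rewrite ?mem_iota.
Qed.

Definition cfannih o : cfser A :=
  CFSer (slinear_annih o) (colfin_annih o).

Lemma annih_comm o o' : GRing.comm (cfannih o) (cfannih o').
Proof.
apply: cfserP; apply: smulC => g h v /=.
have [[n ->]|g0] := annih_supp g; last first.
  by rewrite !g0 (lin0 (slinear_annih _ _)).
have [[n' ->]|h0] := annih_supp h; last first.
  by rewrite !h0 (lin0 (slinear_annih _ _)).
rewrite !annihE.
rewrite !oscl_oscl [RHS]exchange_big.
apply: eq_bigr => i _; apply: eq_bigr => j _.
by rewrite [in LHS]mulrC [in LHS]osc_ann_comm.
Qed.

Lemma sexp_annihD o o' :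
  sexp (annih (fun n => o n + o' n)) = sexp (annih o) ** sexp (annih o').
Proof.
have -> : annih (fun n => o n + o' n) = cf (cfannih o + cfannih o').
  apply/funext => g; apply/funext => v; rewrite cfD /sadd /=.
  have [[n ->]|g0] := annih_supp g; first by rewrite !annihE osclD.
  by rewrite !g0 addr0.
exact: (@sexpD _ (cfannih o) (cfannih o') (@lowers_annih o) (@lowers_annih o')
          (annih_comm o o')).
Qed.

Definition cfexp_annih o : cfser A := cfexp (x := cfannih o) (@lowers_annih o).

Lemma linear_zpowA c g : linear (zpowA c g).
Proof. exact: flin_is_linear. Qed.

Lemma zpowAE c g m beta :
  zpowA c g (fvec m beta) = if zpair c beta == g then fvec m beta else 0.
Proof. exact: flinE. Qed.

Lemma colfin_zpowA c : colfin (zpowA c).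
Proof.
move=> v; exists [fset zpair c b.2 | b in msupp v]%fset => g gv.
rewrite [v]fock_sum (lin_sum (linear_zpowA _ _)) big_seq big1 //= => b bv.
rewrite (linZ (linear_zpowA _ _)) zpowAE.
case: eqP => [gb|]; rewrite ?scaler0 //.
by case/imfsetP: gv; exists b.
Qed.

Definition cfzpow c : cfser A := CFSer (linear_zpowA c) (colfin_zpowA c).

Lemma zpairD c c' beta : zpair (c + c') beta = zpair c beta + zpair c' beta.
Proof.
rewrite /Defs.zpair -big_split; apply: eq_bigr => i _; rewrite -big_split.
by apply: eq_bigr => j _; rewrite /= mxE !mulrDl.
Qed.

Lemma zpowAD c c' : cfzpow c * cfzpow c' = cfzpow (c + c').
Proof.
apply: cfserP; apply/funext => g; apply/funext; rewrite cfM /=.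
apply: lin_ext; first exact: (cf_lin (cfzpow c * cfzpow c')).
  exact: linear_zpowA.
move=> m beta.
have out h : h \notin [fset zpair c' beta]%fset ->
    cf (cfzpow c') h (fvec m beta) = 0.
  by rewrite inE /= zpowAE eq_sym => /negPf ->.
rewrite (smulE _ (linear_zpowA c) out) big_seq_fset1 /= !zpowAE eqxx.
by rewrite zpairD zpowAE [in LHS]eq_sym subr_eq [in LHS]eq_sym.
Qed.

(** Powers of z see the zero modes only through their eigenvalues, so that
linear relations among the a_{i,0} are respected. *)
Lemma eq_zpowA c c' : zpair c =1 zpair c' -> zpowA c = zpowA c'.
Proof.
move=> cc'; apply/funext => g; apply/funext.
apply: lin_ext; [exact: linear_zpowA..|move=> m beta].
by rewrite !zpowAE cc'.
Qed.

(** Oscillators preserve the charge, on which the eigenvalues of the zero modes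
depend. *)
Lemma zpowA_osc c g i n v : zpowA c g (osc i n v) = osc i n (zpowA c g v).
Proof.
apply: (@lin_ext _ (zpowA c g \o osc i n) (osc i n \o zpowA c g)).
- by move=> a u w /=; rewrite linearP linear_zpowA.
- by move=> a u w /=; rewrite linear_zpowA linearP.
move=> m beta /=; rewrite zpowAE; case: n => [[|n]|n].
- rewrite osc0E (linZ (linear_zpowA _ _)) zpowAE.
  by case: ifP => _; rewrite ?osc0E // scaler0 (lin0 (linear_osc _ _)).
- rewrite oscSE (lin_sum (linear_zpowA _ _)).
  case: ifP => zg.
    rewrite oscSE; apply: eq_bigr => j _.
    by rewrite (linZ (linear_zpowA _ _)) zpowAE zg.
  rewrite (lin0 (linear_osc _ _)) big1 // => j _.
  by rewrite (linZ (linear_zpowA _ _)) zpowAE zg scaler0.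
- rewrite oscNE zpowAE.
  by case: ifP => _; rewrite ?oscNE // (lin0 (linear_osc _ _)).
Qed.

Lemma zpowA_cfexp_annih c o : GRing.comm (cfzpow c) (cfexp_annih o).
Proof.
apply: cfserP; apply: smulC => g h v /=.
have lz := linear_zpowA c g.
apply/esym; apply: (scomm_sexp (x := cfannih o)) => //.
  exact: lowers_annih.
move=> {}h {}v /=.
have [[n ->]|h0] := annih_supp h; last by rewrite !h0 (lin0 lz).
rewrite !annihE /Defs.oscl (lin_sum lz); apply: eq_bigr => i _.
by rewrite (linZ lz) zpowA_osc.
Qed.

Lemma linear_expA c : linear (expA c).
Proof. exact: flin_is_linear. Qed.

Lemma expAE c m beta : expA c (fvec m beta) = ex (zpair c beta) *: fvec m beta.
Proof. exact: flinE. Qed.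

Definition cfexpA c : cfser A :=
  CFSer (slinear_sconst (linear_expA c)) (@colfin_sconst _ _).

Lemma zpowA_expA c c' : GRing.comm (cfzpow c) (cfexpA c').
Proof.
apply: cfserP; apply/funext => g; apply/funext => v; rewrite !cfM /=.
rewrite (smul_const _ _ _ (linear_zpowA c)) (sconst_mul _ _ _ (linear_expA c')).
move: v; apply: (@lin_ext _ (zpowA c g \o expA c') (expA c' \o zpowA c g)).
- by move=> a u w /=; rewrite linear_expA linear_zpowA.
- by move=> a u w /=; rewrite linear_zpowA linear_expA.
move=> m beta /=; rewrite expAE (linZ (linear_zpowA _ _)) zpowAE.
by case: ifP => _; rewrite ?expAE // scaler0 (lin0 (linear_expA _)).
Qed.

Lemma linear_expQ c : linear (@expQ A c).
Proof. exact: flin_is_linear. Qed.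

(** The part of a vertex operator to the right of the creation modes; it has
finite columns. *)
Definition cfvertex (f : ffield A) : cfser A :=
  cfzpow (fL f) * cfexpA (fB f) * cfexp_annih (fo f).

Definition left_vertex (f : ffield A) : opser A :=
  sconst (expQ (fQ f)) ** sexp (creat (fo f)).

Lemma slinear_left_vertex f : slinear (left_vertex f).
Proof.
move=> g a u v; rewrite /left_vertex !(sconst_mul _ _ _ (linear_expQ _)).
have lE := slinear_raises_sexp (@slinear_creat (fo f)) (@raises_creat (fo f)).
by rewrite lE (linear_expQ (fQ f)).
Qed.

Lemma vertexE f : vertex f = left_vertex f ** cf (cfvertex f).
Proof. by rewrite /cfvertex -!(smul_cfM _ _ (slinear_left_vertex f)). Qed.

Lemma slinear_vertex f : slinear (vertex f).
Proof.
rewrite vertexE; apply: slinear_smul; first exact: slinear_left_vertex.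
  exact: cf_lin.
exact: cf_fin.
Qed.

(** The power of z commutes with the annihilation modes and with the
exponential of zero modes, and then adds to the one inside the vertex
operator. *)
Lemma vertex_zpowA f c :
  vertex f ** zpowA c = vertex (FField (fQ f) (fL f + c) (fB f) (fo f)).
Proof.
rewrite !vertexE -[zpowA c]/(cf (cfzpow c)).
rewrite (smul_cfM _ _ (slinear_left_vertex f)).
have -> : cfvertex (FField (fQ f) (fL f + c) (fB f) (fo f))
    = cfzpow (fL f) * cfzpow c * cfexpA (fB f) * cfexp_annih (fo f).
  by rewrite zpowAD.
rewrite /cfvertex -!mulrA -(zpowA_cfexp_annih c).
by rewrite [cfexpA _ * (_ * _)]mulrA -(zpowA_expA c) -mulrA.
Qed.

(** The positive modes of both factors commute, so their exponentials multiply
by adding exponents. *)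
Lemma vertex_annih f o :
  vertex f ** sexp (annih o)
  = vertex (FField (fQ f) (fL f) (fB f)
              (fun n => fo f n + (if 0 < n then o n else 0))).
Proof.
rewrite !vertexE -[sexp (annih o)]/(cf (cfexp_annih o)).
rewrite (smul_cfM _ _ (slinear_left_vertex f)).
set o' := fun n => fo f n + (if 0 < n then o n else 0).
have -> : left_vertex (FField (fQ f) (fL f) (fB f) o') = left_vertex f.
  rewrite /left_vertex /=; suff -> : creat o' = creat (fo f) by [].
  by apply: eq_modeser => n v n0; rewrite /o' ltNge (ltW n0) addr0.
have -> : cfvertex (FField (fQ f) (fL f) (fB f) o')
    = cfzpow (fL f) * cfexpA (fB f) * cfexp_annih o' by [].
suff -> : cfexp_annih o' = cfexp_annih (fo f) * cfexp_annih o.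
  by rewrite /cfvertex mulrA.
apply: cfserP; rewrite cfM -[RHS]sexp_annihD /=.
suff -> : annih o' = annih (fun n => fo f n + o n) by [].
by apply: eq_modeser => n v n0; rewrite /o' n0.
Qed.

Lemma expQ_vertex f c :
  sconst (expQ c) ** vertex f = vertex (FField (c + fQ f) (fL f) (fB f) (fo f)).
Proof.
rewrite !vertexE; apply/funext => g; apply/funext => v.
rewrite (sconst_mul _ _ _ (linear_expQ c)).
have [d vd] := cf_fin (cfvertex f) v.
rewrite !(@smulE _ _ _ d) //; try exact: slinear_left_vertex.
rewrite (lin_sum (linear_expQ c)); apply: eq_bigr => h _.
rewrite /left_vertex !(sconst_mul _ _ _ (linear_expQ _)) /=.
move: (sexp _ _ _); apply: (@lin_ext _ (expQ c \o expQ (fQ f))).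
- by move=> a u w /=; rewrite !linear_expQ.
- exact: linear_expQ.
move=> m beta /=; rewrite !expQE -addrA.
suff -> : chargeQ (fQ f) + chargeQ c = chargeQ (c + fQ f) by [].
by apply/rowP => j; rewrite !mxE; ring.
Qed.

(** The zero-mode data are compared only through the charge and the eigenvalues
that they induce: for tau_3 the two fields agree only modulo the relations among
the Q_{a_i} and among the a_{i,0}. *)
Lemma eq_vertex f f' : chargeQ (fQ f) = chargeQ (fQ f') ->
  zpair (fL f) =1 zpair (fL f') -> fB f = fB f' ->
  (forall n, n != 0 -> fo f n = fo f' n) -> vertex f = vertex f'.
Proof.
move=> eQ eL eB eo.
have vE h : vertex h = sconst (expQ (fQ h)) ** sexp (creat (fo h))
    ** zpowA (fL h) ** sconst (expA (fB h)) ** sexp (annih (fo h)) by [].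
have eqQ : @expQ A (fQ f) = expQ (fQ f').
  apply/funext; apply: lin_ext; [exact: linear_expQ..|move=> m beta].
  by rewrite !expQE eQ.
have eqC : creat (fo f) = creat (fo f').
  by apply: eq_modeser => n v /lt_eqF/negbT/eo ->.
have eqA : annih (fo f) = annih (fo f').
  by apply: eq_modeser => n v /gt_eqF/negbT/eo ->.
by rewrite !vE eqQ eqC eqA eB (eq_zpowA eL).
Qed.

End Vertex.

(** * Dressing *)

Section DressedVertex.
Variable A : numFieldType.
Variable gram : int -> 'I_4 -> 'I_4 -> A.
Variable ex : A -> A.
Local Notation vertex := (vertex gram ex).
Local Notation zpowA := (zpowA gram).
Implicit Types (f : ffield A) (c L : 'rV[A]_4) (o : int -> 'rV[A]_4).

Definition fdress f c o L : ffield A :=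
  FField (c + fQ f) (fL f + L) (fB f)
    (fun n => fo f n + (if 0 < n then o n else 0)).

Lemma dressed_vertex f c o L :
  sconst (expQ c) ** (vertex f ** sexp (annih gram o)) ** zpowA L
  = vertex (fdress f c o L).
Proof. by rewrite vertex_annih expQ_vertex vertex_zpowA. Qed.

Lemma dressed_vertex_sub a f f' c o L :
  sconst (expQ c)
    ** (sscale a (ssub (vertex f) (vertex f')) ** sexp (annih gram o))
    ** zpowA L
  = sscale a (ssub (vertex (fdress f c o L)) (vertex (fdress f' c o L))).
Proof.
have lV h : slinear (vertex h) by exact: slinear_vertex.
have lE : slinear (sconst (@expQ A c)) by exact/slinear_sconst/linear_expQ.
have fZ : colfin (zpowA L) by exact: colfin_zpowA.
have fA : colfin (sexp (annih gram o)) by exact: (cf_fin (cfexp_annih gram o)).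
have lA : slinear (sexp (annih gram o)) by exact: (cf_lin (cfexp_annih gram o)).
have lW h : slinear (sconst (expQ c) ** (vertex h ** sexp (annih gram o))).
  rewrite vertex_annih expQ_vertex; exact: lV.
pose W h := sconst (expQ c) ** (vertex h ** sexp (annih gram o)).
transitivity (sscale a (ssub (W f) (W f')) ** zpowA L); last first.
  apply: etrans (smul_sscale_ssub a (lW f) (lW f') fZ) _.
  exact: (congr2 (fun X Y => sscale a (ssub X Y))
            (dressed_vertex f c o L) (dressed_vertex f' c o L)).
apply: (congr1 (fun X => X ** zpowA L)).
apply: etrans (congr1 (smul _) (smul_sscale_ssub a (lV f) (lV f') fA)) _.
exact: (sconst_sscale_ssub a _ _ (@linear_expQ A c)).
Qed.

Lemma dress_annih F (hn : int -> 'rV[A]_4) (a p : A) :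
  F ** sexp (sscale a
    (modeser (fun n => 0 < n)
       (fun n v => (1 - p ^ n)^-1 *: oscl gram (hn n) n v)))
  = F ** sexp (annih gram (fun n => (a * (1 - p ^ n)^-1) *: hn n)).
Proof.
suff -> : sscale a
    (modeser (fun n => 0 < n)
       (fun n v => (1 - p ^ n)^-1 *: oscl gram (hn n) n v))
  = annih gram (fun n => (a * (1 - p ^ n)^-1) *: hn n) by [].
apply/funext => g; apply/funext => v; rewrite /sscale.
have [[n Pn ->]|Pg] := modeser_supp (fun n => 0 < n) g.
  by rewrite /annih !modeserE // osclZ scalerA.
by rewrite /annih !modeser0 // scaler0.
Qed.

(** The eigenvalue form of the relation sum_i a_{i,0} = 0. *)
Lemma zpair_const a beta :
  (forall n i j, gram n i j = gram n j i) ->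
  (forall i, \sum_j gram 0 i j = 0) -> zpair gram (const_mx a) beta = 0.
Proof.
move=> gramC sum0; rewrite /zpair exchange_big big1 //= => j _.
transitivity (a * beta 0 j * \sum_i gram 0 (lift ord0 j) i).
  by rewrite mulr_sumr; apply: eq_bigr => i _; rewrite mxE gramC.
by rewrite sum0 mulr0.
Qed.

End DressedVertex.

(** * The complex exponential and powers of q *)

Section Exponential.
Variable R : realType.
Local Notation C := R[i].
Implicit Types (x y l : C).

Lemma cexpD x y : cexp (x + y) = cexp x * cexp y.
Proof.
case: x y => [a b] [c d]; apply/eqP; rewrite eq_complex /= expRD cosD sinD.
by apply/andP; split; apply/eqP; ring.
Qed.

Lemma cexp0 : cexp (0 : C) = 1.
Proof.
by apply/eqP; rewrite eq_complex /= expR0 cos0 sin0 mulr1 mulr0 !eqxx.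
Qed.

Lemma cexp_neq0 x : cexp x != 0.
Proof.
apply/eqP => x0; have := cexpD x (- x); rewrite subrr cexp0 x0 mul0r.
by move/eqP; rewrite oner_eq0.
Qed.

Lemma cexpN x : cexp (- x) = (cexp x)^-1.
Proof.
by apply: (mulfI (cexp_neq0 x)); rewrite -cexpD subrr cexp0 divff // cexp_neq0.
Qed.

Lemma qpowD l x y : qpow l (x + y) = qpow l x * qpow l y.
Proof. by rewrite /qpow mulrDl cexpD. Qed.

Lemma qpowN l x : qpow l (- x) = (qpow l x)^-1.
Proof. by rewrite /qpow mulNr cexpN. Qed.

Lemma qpow_neq0 l x : qpow l x != 0.
Proof. exact: cexp_neq0. Qed.

Lemma qpow0 l : qpow l 0 = 1.
Proof. by rewrite /qpow mul0r cexp0. Qed.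

Lemma qpow_int l x (n : int) : qpow l (x * n%:~R) = qpow l x ^ n.
Proof.
have qpow_nat (m : nat) : qpow l (x * m%:R) = qpow l x ^+ m.
  elim: m => [|m IHm]; first by rewrite mulr0 qpow0.
  by rewrite -natr1 mulrDr mulr1 qpowD IHm exprSr.
case: n => n; first exact: qpow_nat.
by rewrite NegzE rmorphN mulrN qpowN qpow_nat exprnN.
Qed.

Lemma exprz_neq1 (p : C) (n : int) : p != 0 -> `|p| < 1 -> n != 0 -> p ^ n != 1.
Proof.
move=> p0 p1; have nat_case (m : nat) : p ^+ m.+1 != 1.
  apply/eqP => /(congr1 Num.norm); rewrite normrX normr1 => /eqP.
  by rewrite lt_eqF // exprn_ilt1.
by case: n => [[|n]|n] // _; [exact: nat_case|rewrite NegzE -exprnN invr_eq1].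
Qed.

End Exponential.

(** * Comparison of the fields *)

Section ModeIdentities.
(* Here a, b, c stand for q^n, q^{(k_3+2)n}, q^{(k_2+2)n} and d for q - q^{-1};
   x, y, z are the coefficients of three oscillators, of which z cancels. *)
Variables (F : fieldType) (a b c d n x y z : F).
Hypotheses (a0 : a != 0) (b0 : b != 0) (c0 : c != 0).
Hypotheses (d0 : d != 0) (n0 : n != 0).
Hypotheses (b1 : b * b - 1 != 0) (c1 : c * c - 1 != 0).

Local Notation qn := ((a - a^-1) / d).
Local Notation qN := ((b - b^-1) / d).
Local Notation qM := ((c - c^-1) / d).
Local Notation qK := (((b * c)^-1 - b * c) / d).

Lemma creation_mode (sgn : bool) :
  - n^-1 * (- (qn / qN) * (x + b^-1 * y) - (if sgn then (a - a^-1) * y else 0))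
  = - (- (qn / qN / n) * x) - (if sgn then b else b^-1) * (- (qn / qN / n) * y).
Proof. by case: sgn; field; rewrite ?n0 ?a0 ?b0 ?d0 ?b1. Qed.

Lemma annihilation_mode (sgn : bool) :
  - n^-1 * (qn / qM * ((b * c)^-1 * x + b^-1 * z)
            - (if sgn then (a - a^-1) * y else 0))
    + - d * (1 - b * b)^-1 * (- (qn / (n * qM)) * (qK * x - qM * y - qN * z))
  = - (- (qn / qN / n) * x) - (if sgn then b else b^-1) * (- (qn / qN / n) * y).
Proof.
have b1' : 1 - b * b != 0 by rewrite -opprB oppr_eq0.
by case: sgn; field; rewrite ?n0 ?a0 ?b0 ?c0 ?d0 ?b1 ?c1 ?b1'.
Qed.

End ModeIdentities.

Section Screening.
Variable R : realType.
Local Notation C := R[i].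
Variables logq k1 k2 k3 s : C.
Hypothesis q_lt1 : `|cexp logq| < 1.
Hypothesis sum_k : k1 + k2 + k3 = - 4.
Hypothesis p2_lt1 : `|qpow logq (2 * (k2 + 2))| < 1.
Hypothesis p3_lt1 : `|qpow logq (2 * (k3 + 2))| < 1.
Hypothesis s_ok : 1 + k1 * s != 0.
Local Notation av := (av C).
Local Notation gram := (agram logq k1 k2 k3).
Local Notation vertex := (vertex gram (@cexp R)).
Local Notation p3 := (qpow logq (2 * (k3 + 2))).
Local Notation lambda := ((1 - (k2 + 2) * s) / (k3 + 2)).
Local Notation Qbar := (barQu1 k1 k2 k3).
Local Notation "q^ x" := (qpow logq x) (at level 2, x at level 1).
Local Notation "[[ x ]]" := (qnum logq x).

Lemma sq_neq1 (x : C) (n : int) : `|q^(2 * x)| < 1 -> n != 0 ->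
  q^(x * n%:~R) * q^(x * n%:~R) - 1 != 0.
Proof.
move=> px n0; rewrite subr_eq0 -qpowD -mulrDl -mulr2n -mulr_natl qpow_int.
by apply: exprz_neq1 => //; exact: qpow_neq0.
Qed.

Lemma qdiff_neq0 : qdiff logq != 0.
Proof.
rewrite /qdiff subr_eq0.
apply: contra (@exprz_neq1 _ _ 2 (cexp_neq0 _) q_lt1 isT).
by move=> /eqP qV; rewrite -exprnP expr2 {1}qV mulVf // cexp_neq0.
Qed.

Lemma shift_neq0 (x : C) : `|q^(2 * x)| < 1 -> x != 0.
Proof. by apply: contraTneq => ->; rewrite mulr0 qpow0 normr1 ltxx. Qed.

(** For F_1 and rho_3 the rows [x], [y], [z] are a_1, a_2, a_3; for F_0 and
tau_3 they are a_0, a_3, a_2. For n < 0 the current already has the modes of the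
screening field; for n > 0 the dressing turns them into these. *)
Lemma dressed_modes (x y z : 'rV[C]_4) (b : bool) (n : int) : n != 0 ->
  - n%:~R^-1 *: (let vm := vminus logq k1 k2 k3 x y z n in
                 if b then vm - (q^(n%:~R) - q^(- n%:~R)) *: y else vm)
    + (if 0 < n then
         (- qdiff logq * (1 - p3 ^ n)^-1) *:
           (- ([[n%:~R]] / (n%:~R * [[(k2 + 2) * n%:~R]]))
             *: ([[k1 * n%:~R]] *: x - [[(k2 + 2) * n%:~R]] *: y
                 - [[(k3 + 2) * n%:~R]] *: z))
       else 0)
  = - (- ([[n%:~R]] / [[(k3 + 2) * n%:~R]] / n%:~R) *: x)
    - q^(- (- sg R b * (k3 + 2)) * n%:~R)
        *: (- ([[n%:~R]] / [[(k3 + 2) * n%:~R]] / n%:~R) *: y).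
Proof.
move=> n0; apply/rowP => j.
have nz : n%:~R != 0 :> C by rewrite intr_eq0.
set qx := q^(n%:~R); set qb := q^((k3 + 2) * n%:~R).
set qc := q^((k2 + 2) * n%:~R).
(* k_1 + (k_2 + 2) + (k_3 + 2) = 0 *)
have qk1 : q^(k1 * n%:~R) = (qb * qc)^-1.
  rewrite -qpowD -qpowN; congr (q^_); rewrite -mulrDl -mulNr; congr (_ * _).
  by have -> : k1 = - 4 - k2 - k3 by [rewrite -sum_k; ring]; ring.
have p3E : p3 ^ n = qb * qb by rewrite -qpow_int -qpowD; congr (q^_); ring.
have eE : q^(- (- sg R b * (k3 + 2)) * n%:~R) = if b then qb else qb^-1.
  by case: b; rewrite /sg -?qpowN; congr (q^_); ring.
have eM : q^(- (k3 + 2) * n%:~R) = qb^-1 by rewrite mulNr qpowN.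
set W : 'rV[C]_4 := (let vm := _ in _).
have WE : W 0 j
    = vminus logq k1 k2 k3 x y z n 0 j
      - (if b then (qx - qx^-1) * y 0 j else 0).
  by rewrite /W; case: (b); rewrite ?subr0 // !mxE qpowN.
rewrite mxE [(_ *: W) 0 j]mxE WE eE.
have b1 := sq_neq1 p3_lt1 n0; have c1 := sq_neq1 p2_lt1 n0.
have [qx0 qb0 qc0] : [/\ qx != 0, qb != 0 & qc != 0] by split; exact: qpow_neq0.
have d0 := qdiff_neq0.
rewrite /vminus /qnum !qpowN qk1 eM p3E -/qx -/qb -/qc invrK.
case: (ltgtP n 0) n0 => // [nlt|ngt] _; rewrite ?mxE ?addr0.
  exact: creation_mode.
exact: annihilation_mode.
Qed.

(** Constant rows are the combinations that vanish by sum_i Q_{a_i} = 0 and by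
sum_i a_{i,0} = 0. *)
Lemma eq_current_vertex (f f' : ffield C) c o L a a' :
  c + fQ f = fQ f' + const_mx a -> fL f + L = fL f' + const_mx a' ->
  fB f = fB f' ->
  (forall n, n != 0 -> fo f n + (if 0 < n then o n else 0) = fo f' n) ->
  vertex f' = vertex (fdress f c o L).
Proof.
move=> eQ eL eB eo; apply: eq_vertex => //= [|beta|n /eo //].
  by rewrite eQ; apply/rowP => j; rewrite !mxE; ring.
rewrite eL zpairD zpair_const ?addr0 // => [n i j|i]; first exact: agramC.
exact: sum_agram0.
Qed.

(** The z-powers agree as 1 - s (k_2 + k_3 + 4) = 1 + k_1 s, which cancels the
denominator of h_{1,0} and of the last term of u_{1,0}. *)
Lemma vertex_r3 b : vertex (r3 logq k3 b)
  = vertex (fdress (v1 logq k1 k2 k3 s b) (s *: Qbar)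
      (fun n => (- qdiff logq * (1 - p3 ^ n)^-1) *: h1 logq k1 k2 k3 n)
      (- lambda *: h10 k1 k2 k3 s)).
Proof.
have N0 := shift_neq0 p3_lt1; have M0 := shift_neq0 p2_lt1.
have k1E : k1 = - 4 - k2 - k3 by rewrite -sum_k; ring.
apply: (@eq_current_vertex _ _ _ _ _ 0 0) => [| | |n n0].
- by apply/rowP => j; rewrite !mxE; ring.
- apply/rowP => j; rewrite !mxE; move: s_ok; rewrite k1E => s_ok'.
  by field; rewrite ?N0 ?M0 ?s_ok'.
- by apply/rowP => j; rewrite !mxE; case: b => /=; field; rewrite N0.
- by rewrite [LHS]dressed_modes //= !scaleNr.
Qed.

(** The charge and the z-power of the dressed current are given by (a_1 + a_2) /
(k_3 + 2), those of the screening field by -(a_0 + a_3) / (k_3 + 2); the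
difference is the constant row 1 / (k_3 + 2). *)
Lemma vertex_t3 b : vertex (t3 logq k3 b)
  = vertex (fdress (hatv1 logq k1 k2 k3 s b) (- s *: Qbar)
      (fun n => (- qdiff logq * (1 - p3 ^ n)^-1) *: hath1 logq k1 k2 k3 n)
      (lambda *: h10 k1 k2 k3 s)).
Proof.
have N0 := shift_neq0 p3_lt1; have M0 := shift_neq0 p2_lt1.
have k1E : k1 = - 4 - k2 - k3 by rewrite -sum_k; ring.
have avE (j : 'I_4) : av 3 0 j = 1 - av 0 0 j - av 1 0 j - av 2 0 j.
  by rewrite !mxE; case: j => [ [| [| [| [|j] ] ] ] hj] //=; ring.
apply: (@eq_current_vertex _ _ _ _ _ (k3 + 2)^-1 (k3 + 2)^-1) => [| | |n n0].
- by apply/rowP => j; have := avE j; rewrite !mxE => ->; field.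
- apply/rowP => j; have := avE j; rewrite !mxE => ->.
  move: s_ok; rewrite k1E => s_ok'; by field; rewrite ?N0 ?M0 ?s_ok'.
- by apply/rowP => j; rewrite !mxE; case: b => /=; field; rewrite N0.
- have hE : hath1 logq k1 k2 k3 n
      = - ([[n%:~R]] / (n%:~R * [[(k2 + 2) * n%:~R]]))
          *: ([[k1 * n%:~R]] *: av 0 - [[(k2 + 2) * n%:~R]] *: av 3
              - [[(k3 + 2) * n%:~R]] *: av 2).
    by apply: (congr1 (fun w => _ *: w)); exact: addrAC.
  have vE := dressed_modes (av 0) (av 3) (av 2) b n0.
  by rewrite -hE in vE; apply: etrans vE _; rewrite /= !scaleNr.
Qed.

End Screening.

Lemma smonom_sscale (A : fieldType) (a c : A) (X : opser A) :
  smonom c (sscale a (smonom (- c) X)) = sscale a X.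
Proof. by apply/funext => g; rewrite /smonom /sscale opprK subrK. Qed.

Theorem proposition5p1 (R : realType) (q logq k1 k2 k3 s : R[i])
  (q_neq0 : q != 0) (q_lt1 : `|q| < 1) (logqE : cexp logq = q)
  (sum_k : k1 + k2 + k3 = - 4)
  (p1_lt1 : `|qpow logq (2 * (k1 + 2))| < 1)
  (p2_lt1 : `|qpow logq (2 * (k2 + 2))| < 1)
  (p3_lt1 : `|qpow logq (2 * (k3 + 2))| < 1)
  (s_ok : 1 + k1 * s != 0) :
  let p3 := qpow logq (2 * (k3 + 2)) in
  let lambda := (1 - (k2 + 2) * s) / (k3 + 2) in
  let Qbar :=
    (k3 + 2)^-1 *: (k1 *: av R[i] 1 - (k2 + 2) *: av R[i] 2
                    - (k3 + 2) *: av R[i] 3) in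
  let zpow := zpowA (agram logq k1 k2 k3) in
  smonom 1 (rho3 logq k1 k2 k3)
  = sconst (expQ (s *: Qbar))
    ** pi1_Fdress logq k1 k2 k3 s 1 p3
    ** zpow (- lambda *: h10 k1 k2 k3 s)
  /\
  smonom 1 (tau3 logq k1 k2 k3)
  = sconst (expQ (- s *: Qbar))
    ** pi1_Fdress logq k1 k2 k3 s 0 p3
    ** zpow (lambda *: h10 k1 k2 k3 s).
Proof.
rewrite -logqE in q_lt1 => p3 lambda Qbar zpow.
split; (apply: etrans (smonom_sscale _ _ _) _; apply: esym).
  apply: etrans (congr1 (fun X => _ ** X ** _) (dress_annih _ _ _ _ _)) _.
  apply: etrans (dressed_vertex_sub _ _ _ _ _ _ _ _) _.
  exact: (congr2 (fun X Y => sscale _ (ssub X Y))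
            (esym (vertex_r3 q_lt1 sum_k p2_lt1 p3_lt1 s_ok true))
            (esym (vertex_r3 q_lt1 sum_k p2_lt1 p3_lt1 s_ok false))).
apply: etrans (congr1 (fun X => _ ** X ** _) (dress_annih _ _ _ _ _)) _.
apply: etrans (dressed_vertex_sub _ _ _ _ _ _ _ _) _.
exact: (congr2 (fun X Y => sscale _ (ssub X Y))
          (esym (vertex_t3 q_lt1 sum_k p2_lt1 p3_lt1 s_ok true))
          (esym (vertex_t3 q_lt1 sum_k p2_lt1 p3_lt1 s_ok false))).
Qed.
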